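(* There is an algorithm that, given as input a bull-free graph $G$, determines whether $G$ contains an odd hole, and runs in time $O(|V(G)|^5)$.
   Context: All graphs are finite and simple. For graphs $H,G$, $G$ contains $H$ if $G$ has an induced subgraph isomorphic to $H$; otherwise $G$ is $H$-free. The bull is the graph consisting of a triangle with two disjoint pendant edges (i.e. vertices $x,y,z,p,q$ with $xyz$ a triangle, $p$ adjacent only to $x$, $q$ adjacent only to $y$). A hole is an induced subgraph isomorphic to a cycle $C_k$ with $k\ge 4$; its length is $k$, and it is odd if $k$ is odd. *)

(* Defs.v *)
From mathcomp Require Import all_boot.
Set Implicit Arguments. Unset Strict Implicit. Unset Printing Implicit Defensive.

(* A finite simple graph on vertex type T is an adjacency relation
   e : rel T that is symmetric and irreflexive. *)

Definition contains (T1 T2 : finType) (e1 : rel T1) (e2 : rel T2) : Prop :=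
  exists f : T1 -> T2, injective f /\ forall x y, e2 (f x) (f y) = e1 x y.

Definition bull_edge (i j : nat) : bool :=
  [|| (i == 0) && (j == 1), (i == 1) && (j == 2), (i == 0) && (j == 2)
    , (i == 3) && (j == 0) | (i == 4) && (j == 1)].
Definition bull_rel : rel 'I_5 := fun x y => bull_edge x y || bull_edge y x.

Definition bull_free (T : finType) (e : rel T) : Prop := ~ contains bull_rel e.

Definition cycle_rel (k : nat) : rel 'I_k :=
  fun x y => (val y == (val x).+1 %% k) || (val x == (val y).+1 %% k).

Definition has_odd_hole (T : finType) (e : rel T) : Prop :=
  exists k, [/\ 4 <= k, odd k & contains (@cycle_rel k) e].

Inductive instr : Type :=
| Const of nat & nat
| Add of nat & nat & nat
| Sub of nat & nat & nat    (* Sub r a b   : R[r] := R[a] - R[b] (truncated) *)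
| LoadI of nat & nat
| StoreI of nat & nat
| Jz of nat & nat
| Halt.

Definition program := seq instr.
Definition state := (nat * (nat -> nat))%type.

Definition upd (R : nat -> nat) (r v : nat) : nat -> nat :=
  fun i => if i == r then v else R i.

(* One step; a halted state (Halt or pc outside the program) is a fixpoint. *)
Definition step (p : program) (s : state) : state :=
  let: (pc, R) := s in
  match nth Halt p pc with
  | Const r c => (pc.+1, upd R r c)
  | Add r a b => (pc.+1, upd R r (R a + R b))
  | Sub r a b => (pc.+1, upd R r (R a - R b))
  | LoadI r a => (pc.+1, upd R r (R (R a)))
  | StoreI a r => (pc.+1, upd R (R a) (R r))
  | Jz a t => if R a == 0 then (t, R) else (pc.+1, R)
  | Halt => (pc, R)
  end.

Definition halted (p : program) (s : state) : bool :=
  if nth Halt p s.1 is Halt then true else false.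

Definition exec (p : program) (t : nat) (s : state) : state := iter t (step p) s.

(* Input encoding of a graph on vertex set 'I_n: R[0] = n, and
   R[1 + x*n + y] = 1 if x ~ y, 0 otherwise; all other registers 0; pc = 0. *)
Definition init (n : nat) (adj : rel 'I_n) : state :=
  (0, fun i => if i == 0 then n
               else nat_of_bool [exists x : 'I_n, exists y : 'I_n,
                                   (i == (x * n + y).+1) && adj x y]).

(* Main.v *)
Require Import Defs.
From mathcomp Require Import all_boot.
From mathcomp Require Import zify.
From Stdlib Require Import FunctionalExtensionality.
Set Implicit Arguments. Unset Strict Implicit. Unset Printing Implicit Defensive.

(* For all vertices a, r, b with a, b nonadjacent, delete from G the neighbours
   of r other than a and b, and run a breadth-first search from r, with parent
   function f. There is an odd hole iff for some (a, r, b) some edge uv joins two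
   vertices of the same level with f(u) not adjacent to v and f(v) not adjacent
   to u; each search and test takes O(n^2).
   If such an edge exists, follow f from u and v until a vertex w is adjacent to
   both current vertices p and q. If p and q are adjacent, then w, p, q, the
   previous p and the parent of w form a bull; otherwise the two paths and w
   contain an odd hole.
   Conversely, let every edge inside a level have a common parent, and consider an
   odd hole through a, r, b. A vertex one level up adjacent to one end of a flat
   edge is adjacent to the other one, as otherwise there is a bull, so each maximal
   run of the hole inside a level enters and leaves from below. Bull-freeness
   leaves only runs with two flat edges, which contradicts the odd length. *)

(** * Levels and odd holes in bull-free graphs *)

(* Boolean hypotheses on non-arithmetic predicates make [lia] very slow. *)
Ltac arith_hyp P :=
  lazymatch P with
  | is_true (leq _ _) => idtac
  | is_true (_ && _) => idtac
  | is_true (odd _) => idtac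
  | is_true (~~ (_ || _)) => idtac
  | is_true (~~ (@eq_op _ _ _)) => idtac
  | _ /\ _ => idtac
  | @eq nat _ _ => idtac
  | odd _ = odd _ => idtac
  | nat => idtac
  end.
Ltac arith :=
  intros;
  repeat match goal with H : ?P |- _ => tryif arith_hyp P then fail else clear H end;
  lia.

Section Layers.
Variables (T : eqType) (e : rel T).

Definition no_bull := forall x y z p q, e x y -> e y z -> e x z -> e p x -> e q y ->
  ~~ e p y -> ~~ e p z -> ~~ e q x -> ~~ e q z -> ~~ e p q -> False.

(** Distinctness of the vertices is derived from the adjacencies when [k >= 5]; for [k = 4] two
    opposite vertices could coincide. *)
Definition hole (k : nat) (c : nat -> T) :=
  forall i j, i < j -> j < k ->
    e (c i) (c j) = (j == i.+1) || (i == 0) && (j == k.-1).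

Definition hole_through a r b := exists k c,
  [/\ 5 <= k, odd k, hole k c & [/\ c 0 = r, c 1 = a & c k.-1 = b]].

(** What is kept of a breadth-first search, with [ok] the reached vertices. The deletion of the
    neighbours of [r] other than two nonadjacent ones enters through [lay_stable]. *)
Record layering (ok : pred T) (r : T) (lev : T -> nat) (par : T -> T) : Prop := Layering {
  lay_root : ok r;
  lay_root0 : lev r = 0;
  lay_par : forall v, ok v -> v != r ->
    [/\ ok (par v), e (par v) v & lev v = (lev (par v)).+1];
  lay_edge : forall u v, ok u -> ok v -> e u v -> lev v <= (lev u).+1;
  lay_stable : forall u v, ok u -> ok v -> lev u = 1 -> lev v = 1 -> ~~ e u v }.

Hypotheses (esy : symmetric e) (eirr : irreflexive e) (nb : no_bull).

(** Equal vertices have the same neighbours, but on a cycle of length at least 5 no other vertex is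
    adjacent to both cycle neighbours of [c i]. *)
Lemma hole_inj k c i j : 5 <= k -> hole k c -> i < j -> j < k -> c i <> c j.
Proof.
move=> k5 hc ij jk cij.
have nb_eq m : e (c m) (c i) = e (c m) (c j) by rewrite cij.
have nij : ~~ ((j == i.+1) || (i == 0) && (j == k.-1)) by rewrite -hc // cij eirr.
case: (posnP i) => i0.
  have := nb_eq 1; have := nb_eq k.-1.
  rewrite ![e _ (c i)]esy ![e (c k.-1) (c j)]esy !hc; try arith.
  by clear nb_eq cij; lia.
have := nb_eq i.-1; have := nb_eq i.+1.
rewrite [e (c i.+1) (c i)]esy !hc; try arith.
by clear nb_eq cij; lia.
Qed.

Variables (ok : pred T) (r : T) (lev : T -> nat) (par : T -> T).
Hypothesis lay : layering ok r lev par.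

Lemma lay_far u v : ok u -> ok v -> (lev u).+1 < lev v -> ~~ e u v.
Proof. by move=> hu hv h; apply/negP => /(lay_edge lay hu hv); arith. Qed.

Lemma lay_far' u v : ok u -> ok v -> (lev u).+1 < lev v -> ~~ e v u.
Proof. by move=> hu hv h; rewrite esy lay_far. Qed.

Lemma lay_parS v : ok v -> 0 < lev v ->
  [/\ ok (par v), e (par v) v & lev v = (lev (par v)).+1].
Proof.
move=> hv h; apply: (lay_par lay) => //; apply: contraL h => /eqP->.
by rewrite (lay_root0 lay).
Qed.

Lemma lay_lev0 v : ok v -> lev v = 0 -> v = r.
Proof. by move=> hv h; apply/eqP; apply/negPn/negP => /(lay_par lay hv) [_ _]; arith. Qed.

Lemma iter_par v t : ok v -> t <= lev v ->
  ok (iter t par v) /\ lev (iter t par v) = lev v - t.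
Proof.
move=> hv; elim: t => [|t IH] ht; first by rewrite subn0.
have [h1 h2] := IH (ltnW ht).
have [|h3 h4 h5] := lay_parS h1; first by arith.
by split=> //=; arith.
Qed.

Lemma iter_par_edge v t : ok v -> t < lev v -> e (iter t.+1 par v) (iter t par v).
Proof.
move=> hv ht; have [h1 h2] := iter_par hv (ltnW ht).
by have [|h3 h4 h5] := lay_parS h1; first arith.
Qed.

Lemma flat_edge_hole u v : ok u -> ok v -> e u v -> lev u = lev v ->
  ~~ e (par u) v -> ~~ e (par v) u -> exists a b c, hole_through a b c.
Proof.
move=> hu hv euv luv npu npv.
set p := fun t => iter t par u; set q := fun t => iter t par v.
set L := lev u.
have okp t : t <= L -> ok (p t) by move=> h; case: (iter_par hu h).
have okq t : t <= L -> ok (q t) by rewrite /L luv => h; case: (iter_par hv h).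
have levp t : t <= L -> lev (p t) = L - t by move=> h; case: (iter_par hu h).
have levq t : t <= L -> lev (q t) = L - t.
  by rewrite /L luv => h; case: (iter_par hv h).
have ep t : t < L -> e (p t.+1) (p t) by move=> h; apply: iter_par_edge.
have eq_ t : t < L -> e (q t.+1) (q t).
  by rewrite /L luv => h; apply: iter_par_edge.
have luL : lev u = L by [].
have lvL : lev v = L by rewrite -luv.
have [p0 q0 p1 q1] : [/\ p 0 = u, q 0 = v, p 1 = par u & q 1 = par v] by [].
clearbody p q L.
(* Level 0 is [r] alone and level 1 is stable, so a flat edge has level at least 2. *)
have L2 : 2 <= L.
  case: (ltngtP L 1) => // hL.
    have h0 : L = 0 by arith.
    have ur : u = r by apply: lay_lev0; rewrite // luL.
    have vr : v = r by apply: lay_lev0; rewrite // lvL.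
    by move: euv; rewrite ur vr eirr.
  by move: (lay_stable lay hu hv); rewrite luL lvL hL euv => /(_ erefl erefl).
have pqL : p L.-1.+1 = q L.-1.+1.
  rewrite prednK; last by arith.
  have -> : p L = r by apply: lay_lev0; [apply: okp | rewrite levp ?subnn].
  by apply/esym/lay_lev0; [apply: okq | rewrite levq ?subnn].
have L1L : L.-1 < L by arith.
(* The two ancestor paths meet at [r], which gives a crossing edge at [L.-1]. The least crossing
   index [t0] is positive by the hypotheses on the parents of [u] and [v]. *)
pose cross t := e (p t.+1) (q t) || e (p t) (q t.+1).
have exc : exists t, cross t.
  exists L.-1; rewrite /cross; apply/orP; left.
  by rewrite pqL eq_.
case: (ex_minnP exc) => t0 ct0 mint0.
have t00 : 0 < t0.
  by case: (posnP t0) ct0 => // ->; rewrite /cross p0 q0 p1 q1 (negbTE npu) esy (negbTE npv).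
have t0L : t0 < L.
  by have := mint0 L.-1; rewrite /cross pqL eq_ // => /(_ isT) h; arith.
have ncr1 t : t < t0 -> ~~ e (p t.+1) (q t).
  by move=> h; apply/negP => h1; have := mint0 t; rewrite /cross h1 => /(_ isT); arith.
have ncr2 t : t < t0 -> ~~ e (p t) (q t.+1).
  move=> h; apply/negP => h1; have := mint0 t.
  by rewrite /cross h1 orbT => /(_ isT); arith.
have [w [okw levw ewp ewq]] : exists w, [/\ ok w, lev w = L - t0.+1, e w (p t0) & e w (q t0)].
  case/orP: ct0 => h.
    by exists (p t0.+1); rewrite okp // levp // ep.
  by exists (q t0.+1); rewrite okq // levq // eq_ // esy.
case epq: (e (p t0) (q t0)).
  have w1 : 0 < lev w.
    case: (posnP (lev w)) => // h.
    by move: (lay_stable lay (okp t0 (ltnW t0L)) (okq t0 (ltnW t0L)));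
      rewrite levp ?levq ?epq; try arith; move=> H; case/negP: (H ltac:(arith) ltac:(arith)).
  have [okx exw levx] := lay_parS okw w1.
  have e1 : e (p t0.-1) (p t0) by rewrite esy -{1}(prednK t00) ep; arith.
  have okp1 : ok (p t0.-1) by apply: okp; arith.
  have lp1 : lev (p t0.-1) = L - t0.-1 by apply: levp; arith.
  have okp0 : ok (p t0) by apply: okp; arith.
  have okq0 : ok (q t0) by apply: okq; arith.
  have lp0 : lev (p t0) = L - t0 by apply: levp; arith.
  have lq0 : lev (q t0) = L - t0 by apply: levq; arith.
  (* The pendant vertices lie one level beyond the triangle on each side; the only nonadjacency not
     due to levels comes from the minimality of [t0]. *)
  exfalso; apply: (nb (x := p t0) (y := w) (z := q t0) (p := p t0.-1) (q := par w)) => //.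
  - by rewrite esy.
  - by apply: lay_far' => //; arith.
  - by have := ncr2 t0.-1; rewrite prednK //; apply; arith.
  - by apply: lay_far => //; arith.
  - by apply: lay_far => //; arith.
  - by apply: lay_far' => //; arith.
(* Going back from [w] towards [u] and [v], [g] is the first distance at which the paths are joined
   by a flat edge; [g = t0] qualifies since [u] and [v] are adjacent. *)
pose P g := [&& 0 < g, g <= t0 & e (p (t0 - g)) (q (t0 - g))].
have exg : exists g, P g by exists t0; rewrite /P t00 leqnn subnn p0 q0.
case: (ex_minnP exg) => g /and3P[g0 gt0 eg] ming.
have ngh h : h < g -> ~~ e (p (t0 - h)) (q (t0 - h)).
  case: (posnP h) => [->|h0] hg; first by rewrite subn0 epq.
  apply/negP => h1.
  have gh : g <= h by apply: ming; rewrite /P h0 h1 andbT; arith.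
  by arith.
(* The cycle follows [p] up to [p t0], passes through [w] and returns along [q]: twice [g.+1]
   vertices plus one. *)
pose c i := if i <= g then p (t0 - g + i) else if i == g.+1 then w
            else q (t0 - (i - g.+2)).
exists (c 1), (c 0), (c (2 * g + 3).-1), (2 * g + 3), c; split=> //; try arith.
have cp i : i <= g -> c i = p (t0 - g + i) by rewrite /c => ->.
have cw : c g.+1 = w by rewrite /c ltnn eqxx.
have cq i : g.+2 <= i -> c i = q (t0 - (i - g.+2)).
  by move=> h; rewrite /c ifN 1?ifN //; arith.
have okpp i : i <= g -> ok (p (t0 - g + i)) by move=> h; apply: okp; arith.
have okqq i : ok (q (t0 - i)) by apply: okq; arith.
have lpp i : i <= g -> lev (p (t0 - g + i)) = L - (t0 - g + i) by move=> h; apply: levp; arith.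
have lqq i : lev (q (t0 - i)) = L - (t0 - i) by apply: levq; arith.
move=> i j ij jk.
case: (ltngtP j g.+1) => jg.
- rewrite !cp; try arith.
  case: (ltngtP j i.+1) => h; first by arith.
    have -> : e (p (t0 - g + i)) (p (t0 - g + j)) = false; last by arith.
    by apply/negbTE; apply: lay_far'; rewrite ?okpp ?lpp; arith.
  by rewrite h addnS esy ep //; arith.
- case: (ltngtP i g.+1) => ig.
  + rewrite (cp i) ?(cq j) //.
    set b := j - g.+2.
    (* One vertex on each path: levels two apart have no edge, levels one apart have none by
       minimality of [t0], and equal levels have one only at the end by minimality of [g]. *)
    case: (ltngtP (t0 - g + i) (t0 - b)) => hab.
    * have -> : e (p (t0 - g + i)) (q (t0 - b)) = false; last by arith.
      apply/negbTE; case: (ltngtP (t0 - g + i).+1 (t0 - b)) => h1.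
      - by apply: lay_far'; rewrite ?okqq ?okpp ?lpp ?lqq; arith.
      - by arith.
      - by rewrite -h1; apply: ncr2; arith.
    * have -> : e (p (t0 - g + i)) (q (t0 - b)) = false; last by arith.
      apply/negbTE; case: (ltngtP (t0 - b).+1 (t0 - g + i)) => h1.
      - by apply: lay_far; rewrite ?okqq ?okpp ?lpp ?lqq; arith.
      - by arith.
      - by rewrite -h1; apply: ncr1; arith.
    * rewrite hab; case: (ltngtP b g) => hb; last 1 first.
      - by rewrite hb eg; arith.
      - by rewrite (negbTE (ngh _ hb)); arith.
      - by arith.
  + rewrite !cq; try arith.
    case: (ltngtP j i.+1) => h; first by arith.
    have -> : e (q (t0 - (i - g.+2))) (q (t0 - (j - g.+2))) = false; last by arith.
    by apply/negbTE; apply: lay_far; rewrite ?okqq ?lqq; arith.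
  have -> : i - g.+2 = (j - g.+2).-1 by arith.
  have -> : t0 - (j - g.+2).-1 = (t0 - (j - g.+2)).+1 by arith.
  by rewrite eq_; arith.
  + rewrite ig cw (cq j) //; case: (ltngtP j g.+2) => h.
    * by arith.
    * have -> : e w (q (t0 - (j - g.+2))) = false; last by arith.
      by apply/negbTE; apply: lay_far => //; rewrite lqq levw; arith.
    * by rewrite h subnn subn0 ewq; arith.
- rewrite jg cw cp; last by arith.
  case: (ltngtP i g) => h; last 1 first.
  + by rewrite h subnK // esy ewp; arith.
  + have -> : e (p (t0 - g + i)) w = false; last by arith.
    by apply/negbTE; apply: lay_far' => //; rewrite ?okpp ?lpp; arith.
  + by arith.
Qed.

(** * When every flat edge passes the test, no odd hole remains *)

Hypothesis pass : forall u v, ok u -> ok v -> e u v -> lev u = lev v ->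
  e (par u) v || e (par v) u.

(** The vertex [x] serves as a pendant vertex at [w] in a bull; it exists because a flat edge has
    level at least 2. *)
Lemma flat_parent u v : ok u -> ok v -> e u v -> lev u = lev v ->
  exists w x, [/\ ok w, e w u, e w v & lev u = (lev w).+1] /\
              [/\ ok x, e x w & lev w = (lev x).+1].
Proof.
move=> hu hv euv luv.
have l2 : 2 <= lev u.
  case: (ltngtP (lev u) 1) => // hL.
    have h0 : lev u = 0 by arith.
    move: euv; rewrite (lay_lev0 hu h0) (lay_lev0 hv) ?eirr //.
    by rewrite -luv.
  by move: (lay_stable lay hu hv hL); rewrite -luv euv => /(_ hL).
have [|a1 a2 a3] := lay_parS hu; first by arith.
have [|b1 b2 b3] := lay_parS hv; first by arith.
have [|c1 c2 c3] := lay_parS a1; first by arith.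
have [|d1 d2 d3] := lay_parS b1; first by arith.
case/orP: (pass hu hv euv luv) => h.
  by exists (par u), (par (par u)).
by exists (par v), (par (par v)); split; split=> //; arith.
Qed.

(** Otherwise the triangle on [u], [v] and a common parent [w] forms a bull with [y] pendant at [u]
    and a neighbour of [w] nearer to the root pendant at [w]. *)
Lemma flat_up u v y : ok u -> ok v -> ok y -> e u v -> lev u = lev v ->
  lev y = (lev u).+1 -> e y u -> e y v.
Proof.
move=> hu hv hy euv luv ly yu; apply/negPn/negP => yv.
have [w [x [[w1 w2 w3 w4] [x1 x2 x3]]]] := flat_parent hu hv euv luv.
apply: (nb (x := u) (y := w) (z := v) (p := y) (q := x)) => //.
- by rewrite esy.
- by apply: lay_far' => //; arith.
- by apply: lay_far => //; arith.
- by apply: lay_far => //; arith.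
- by apply: lay_far' => //; arith.
Qed.

(** Otherwise the triangle [u], [w], [v] forms a bull with [z] pendant at [u] and [par w] pendant at
    [w]. *)
Lemma flat_side u v w z : ok u -> ok v -> ok w -> ok z -> e u v -> lev u = lev v ->
  e w u -> e w v -> lev u = (lev w).+1 -> lev z = lev u -> e z u -> ~~ e z v -> e z w.
Proof.
move=> hu hv hw hz euv luv wu wv lw lz zu nzv; apply/negPn/negP => zw.
have l1 : 0 < lev w.
  case: (posnP (lev w)) => // h0.
  by case/negP: (lay_stable lay hu hv ltac:(arith) ltac:(arith)).
have [x1 x2 x3] := lay_parS hw l1.
apply: (nb (x := u) (y := w) (z := v) (p := z) (q := par w)) => //.
- by rewrite esy.
- by apply: lay_far => //; arith.
- by apply: lay_far => //; arith.
- by apply: lay_far' => //; arith.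
Qed.

(** Index and level have the same parity at the start of each run, from [c 1] to the last vertex;
    but that one has level 1 and the even index [k.-1]. *)
Lemma no_hole_through k c : 5 <= k -> odd k -> hole k c -> c 0 = r ->
  (forall i, i < k -> ok (c i)) -> False.
Proof.
move=> k5 kodd hc c0 okc.
have lv0 : lev (c 0) = 0 by rewrite c0 (lay_root0 lay).
have levpos i : 0 < i -> i < k -> 0 < lev (c i).
  move=> i0 ik; case: (posnP (lev (c i))) => // h.
  by case: (hole_inj k5 hc i0 ik); rewrite c0 (lay_lev0 (okc _ ik) h).
have adjlev i : i.+1 < k ->
    (lev (c i) <= (lev (c i.+1)).+1) /\ (lev (c i.+1) <= (lev (c i)).+1).
  move=> ik; have h : e (c i) (c i.+1) by rewrite hc // eqxx.
  have o1 := okc i ltac:(arith); have o2 := okc i.+1 ltac:(arith).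
  by split; apply: (lay_edge lay) => //; rewrite esy.
have lvlast : lev (c k.-1) = 1.
  have h : e (c 0) (c k.-1) by rewrite hc //; arith.
  have := lay_edge lay (okc 0 ltac:(arith)) (okc k.-1 ltac:(arith)) h.
  have := levpos k.-1 ltac:(arith) ltac:(arith); arith.
have lv1 : lev (c 1) = 1.
  have := adjlev 0 ltac:(arith); have := levpos 1 isT ltac:(arith); arith.
(* A maximal run of equal levels on the hole has exactly three vertices, that
   is two flat edges, so the parity of the level follows that of the index. *)
suff main m i : k.-1 - i <= m -> 0 < i < k -> odd (lev (c i)) = odd i ->
    lev (c i.-1) != lev (c i) -> odd k.-1.
  have := main k 1 ltac:(arith) ltac:(arith); rewrite lv1 /= lv0 => /(_ erefl isT); arith.
elim: m i => [|m IH] i hm /andP[i0 ik] par_i clean.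
  have ei : i = k.-1 by arith.
  by move: par_i; rewrite ei lvlast => <-.
case: (ltngtP i k.-1) => hik; [|by arith|by move: par_i; rewrite hik lvlast => <-].
case: (eqVneq (lev (c i)) (lev (c i.+1))) => flat; last first.
  by apply: (IH i.+1) => //=; try arith; have := adjlev i ltac:(arith); arith.
have {}flat : lev (c i) = lev (c i.+1) by [].
have oki := okc i ik; have oki1 := okc i.+1 ltac:(arith).
have e01 : e (c i) (c i.+1) by rewrite hc //; arith.
have l2 : 2 <= lev (c i).
  have lp := levpos i i0 ik; case: (ltngtP (lev (c i)) 1) => // [|h]; first by arith.
  by case/negP: (lay_stable lay oki oki1 h ltac:(arith)).
have i2 : 2 <= i by case: (ltngtP i 1) => [||h]; try arith; rewrite h lv1 in l2.
have ik2 : i.+2 < k.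
  case: (ltngtP i.+2 k) => // [|h]; first by arith.
  by have := lvlast; have -> : k.-1 = i.+1; arith.
have okm := okc i.-1 ltac:(arith); have oki2 := okc i.+2 ik2.
have em : e (c i.-1) (c i) by rewrite hc //; arith.
have e12 : e (c i.+1) (c i.+2) by rewrite hc //; arith.
have nm1 : ~~ e (c i.-1) (c i.+1) by rewrite hc //; arith.
have n02 : ~~ e (c i) (c i.+2) by rewrite hc //; arith.
have nm2 : ~~ e (c i.-1) (c i.+2) by rewrite hc //; arith.
(* If the run were entered from the level farther from the root, [flat_up] would create the chord
   from [c i.-1] to [c i.+1]. *)
have lm : lev (c i) = (lev (c i.-1)).+1.
  have [h1 h2] := adjlev i.-1 ltac:(arith); rewrite prednK // in h1 h2.
  case: (ltngtP (lev (c i.-1)) (lev (c i))) => h; [by arith| |by rewrite h eqxx in clean].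
  by case/negP: nm1; apply: (flat_up oki oki1 okm) => //; arith.
have [w [x [[w1 w2 w3 w4] [x1 x2 x3]]]] := flat_parent oki oki1 e01 flat.
(* An edge between [w] and [c i.-1] would be flat, and [flat_up] would pass the neighbour [c i.+1]
   of [w] on to [c i.-1]. *)
have nwm : ~~ e w (c i.-1).
  apply/negP => h; case/negP: nm1; rewrite esy.
  by apply: (flat_up w1 okm) => //; rewrite ?[e (c _) w]esy //; arith.
have l12 : lev (c i.+2) <= lev (c i).
  have [h1 h2] := adjlev i.+1 ik2.
  case: (ltngtP (lev (c i.+2)) (lev (c i))) => // h.
  case/negP: n02; rewrite esy; apply: (flat_up oki1 oki) => //; try arith; by rewrite esy.
(* Leaving after a single flat edge gives a bull: triangle [c i], [c i.+1], [w] with pendants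
   [c i.-1] and [c i.+2]. *)
have flat2 : lev (c i.+2) = lev (c i).
  have [h1 h2] := adjlev i.+1 ik2.
  case: (ltngtP (lev (c i.+2)) (lev (c i))) => // h; last by arith.
  have nw2 : ~~ e w (c i.+2).
    apply/negP => h'; case/negP: n02.
    by apply: (flat_up w1 oki2) => //; rewrite ?[e (c _) w]esy //; arith.
  exfalso; apply: (nb (x := c i) (y := c i.+1) (z := w) (p := c i.-1) (q := c i.+2)) => //;
    by rewrite // esy.
have ik3 : i.+3 < k.
  case: (ltngtP i.+3 k) => // [|h]; first by arith.
  by have := lvlast; have -> : k.-1 = i.+2; arith.
have oki3 := okc i.+3 ik3.
have e23 : e (c i.+2) (c i.+3) by rewrite hc //; arith.
have n13 : ~~ e (c i.+1) (c i.+3) by rewrite hc //; arith.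
have n03 : ~~ e (c i) (c i.+3) by rewrite hc //; arith.
have w_2 : e (c i.+2) w.
  by apply: (@flat_side (c i.+1) (c i)) => //; rewrite 1?esy //; arith.
have [h1 h2] := adjlev i.+2 ik3.
(* A third flat edge would make [c i.+3] adjacent to [w], giving a bull: triangle [c i], [w],
   [c i.+1] with [c i.-1] pendant at [c i] and [c i.+3] at [w]. *)
have l3 : (lev (c i.+3)).+1 = lev (c i).
  case: (ltngtP (lev (c i.+3)) (lev (c i))) => h; first by arith.
    case/negP: n13; rewrite esy; apply: (flat_up oki2 oki1) => //; try arith; by rewrite esy.
  have ik4 : i.+4 < k.
    case: (ltngtP i.+4 k) => // [|h']; first by arith.
    by have := lvlast; have -> : k.-1 = i.+3; arith.
  have nm3 : ~~ e (c i.-1) (c i.+3) by rewrite hc //; arith.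
  have w_3 : e (c i.+3) w.
    by apply: (@flat_side (c i.+2) (c i.+1)) => //; rewrite 1?esy //; arith.
  exfalso; apply: (nb (x := c i) (y := w) (z := c i.+1) (p := c i.-1) (q := c i.+3)) => //;
    by rewrite // esy.
(* The index has grown by 3 and the level has dropped by 1, so their parities still agree. *)
by apply: (IH i.+3) => //=; arith.
Qed.

End Layers.

(** * A structured language compiled to the RAM *)

Definition nvars := 18.
Definition scratch1 := 2.
Definition scratch2 := 3.
(* Register layout: the variables come first, and the remaining registers are
   eight interleaved arrays of unbounded length, so that no base address
   depends on the input. *)
Definition cell (k j : nat) : nat := nvars + k + 8 * j.

Inductive cmd : Type :=
| CConst of nat & nat
| CAdd of nat & nat & nat
| CSub of nat & nat & nat
| CLoad of nat & nat & nat
| CStore of nat & nat & nat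
| CRaw of nat & nat
| CSeq of cmd & cmd
| CWhen of nat & cmd
| CFor of nat & cmd.

Notation "c1 ;; c2" := (CSeq c1 c2) (at level 60, right associativity).

Record store : Type := Store { var : nat -> nat; arr : nat -> nat -> nat }.

Definition setv (s : store) x v := Store (upd (var s) x v) (arr s).
Definition seta (s : store) k j v :=
  Store (var s) (fun k' j' => if (k' == k) && (j' == j) then v else arr s k' j').
(* Reading by absolute address, with the junk value 0 on the variables. *)
Definition raw (s : store) a :=
  if a < nvars then 0 else arr s ((a - nvars) %% 8) ((a - nvars) %/ 8).

(** Every loop has the value of variable 0 as its bound, which is the number of vertices. *)
Fixpoint eval (c : cmd) (s : store) : store :=
  match c with
  | CConst x m => setv s x m
  | CAdd x y z => setv s x (var s y + var s z)
  | CSub x y z => setv s x (var s y - var s z)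
  | CLoad x k y => setv s x (arr s k (var s y))
  | CStore k y x => seta s k (var s y) (var s x)
  | CRaw x y => setv s x (raw s (var s y))
  | CSeq c1 c2 => eval c2 (eval c1 s)
  | CWhen x c => if var s x == 0 then s else eval c s
  | CFor i c =>
      setv (foldl (fun s' k => eval c (setv s' i k)) s (iota 0 (var s 0))) i (var s 0)
  end.

(* A loop runs its body before testing the bound, hence the hypothesis [0 < n]
   of [compile_correct]. *)
Fixpoint compile (off : nat) (c : cmd) : program :=
  match c with
  | CConst x m => [:: Const x m]
  | CAdd x y z => [:: Add x y z]
  | CSub x y z => [:: Defs.Sub x y z]
  | CLoad x k y =>
      [:: Add scratch1 y y; Add scratch1 scratch1 scratch1;
          Add scratch1 scratch1 scratch1; Const scratch2 (nvars + k);
          Add scratch1 scratch1 scratch2; LoadI x scratch1]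
  | CStore k y x =>
      [:: Add scratch1 y y; Add scratch1 scratch1 scratch1;
          Add scratch1 scratch1 scratch1; Const scratch2 (nvars + k);
          Add scratch1 scratch1 scratch2; StoreI scratch1 x]
  | CRaw x y =>
      [:: Const scratch1 nvars.-1; Defs.Sub scratch1 y scratch1; Const x 0;
          Jz scratch1 (off + 5); LoadI x y]
  | CSeq c1 c2 => compile off c1 ++ compile (off + size (compile off c1)) c2
  | CWhen x c => Jz x (off.+1 + size (compile off.+1 c)) :: compile off.+1 c
  | CFor i c =>
      Const i 0 :: compile off.+1 c ++
        [:: Const scratch1 1; Add i i scratch1; Add scratch1 i scratch1;
            Defs.Sub scratch1 scratch1 0; Jz scratch1 off.+1]
  end.

(** * Running time as a polynomial in the number of vertices *)

Fixpoint cost (n : nat) (c : cmd) : nat :=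
  match c with
  | CSeq c1 c2 => cost n c1 + cost n c2
  | CWhen _ c => (cost n c).+1
  | CFor _ c => (n * (cost n c + 5)).+1
  | _ => 6
  end.

Fixpoint depth (c : cmd) : nat :=
  match c with
  | CSeq c1 c2 => maxn (depth c1) (depth c2)
  | CWhen _ c => depth c
  | CFor _ c => (depth c).+1
  | _ => 0
  end.

Fixpoint factor (c : cmd) : nat :=
  match c with
  | CSeq c1 c2 => factor c1 + factor c2
  | CWhen _ c => (factor c).+1
  | CFor _ c => factor c + 6
  | _ => 6
  end.

(** Only a loop raises the exponent; additive constants are absorbed by [1 <= n ^ d]. *)
Lemma cost_poly n c : 0 < n -> cost n c <= factor c * n ^ depth c.
Proof.
move=> n0; have pos d : 0 < n ^ d by rewrite expn_gt0 n0.
elim: c => //= [c1 IH1 c2 IH2|_ c IH|_ c IH].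
- rewrite mulnDl leq_add //.
    by apply: leq_trans IH1 _; rewrite leq_mul2l leq_pexp2l ?leq_maxl ?orbT.
  by apply: leq_trans IH2 _; rewrite leq_mul2l leq_pexp2l ?leq_maxr ?orbT.
- by rewrite mulSn -add1n leq_add.
- rewrite expnS; have := pos (depth c); move: (n ^ depth c) IH => m IH m0.
  have : n * cost n c <= n * (factor c * m) by rewrite leq_mul2l IH orbT.
  have : n <= n * m by rewrite leq_pmulr.
  by nia.
Qed.

(** * Frame properties and the loop rule *)

Fixpoint mods (c : cmd) : seq nat :=
  match c with
  | CConst x _ | CAdd x _ _ | CSub x _ _ | CLoad x _ _ | CRaw x _ => [:: x]
  | CStore _ _ _ => [::]
  | CSeq c1 c2 => mods c1 ++ mods c2
  | CWhen _ c => mods c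
  | CFor i c => i :: mods c
  end.

Fixpoint amods (c : cmd) : seq nat :=
  match c with
  | CStore k _ _ => [:: k]
  | CSeq c1 c2 => amods c1 ++ amods c2
  | CWhen _ c | CFor _ c => amods c
  | _ => [::]
  end.

Lemma eval_var c s x : x \notin mods c -> var (eval c s) x = var s x.
Proof.
elim: c s => //= [x1 m|x1 y1 z1|x1 y1 z1|x1 y1 z1|x1 y1|c1 IH1 c2 IH2|y c IH|y c IH] s;
  rewrite ?inE ?mem_cat ?negb_or /upd; try by move/negbTE->.
- by case/andP=> h1 h2; rewrite IH2 // IH1.
- by move=> h; case: eqP => // _; apply: IH.
- case/andP=> /negbTE nx h; rewrite nx; move: (iota 0 _) => l.
  by elim: l s => //= k l IHl s; rewrite IHl IH //= /upd nx.
Qed.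

Lemma eval_arr c s k : k \notin amods c -> arr (eval c s) k = arr s k.
Proof.
elim: c s => //= [k1 y x|c1 IH1 c2 IH2|y c IH|y c IH] s; rewrite ?inE ?mem_cat ?negb_or.
- by move/negbTE->.
- by case/andP=> h1 h2; rewrite IH2 // IH1.
- by move=> h; case: eqP => // _; apply: IH.
- by move=> h; move: (iota 0 _) => l; elim: l s => //= i l IHl s; rewrite IHl IH.
Qed.

Lemma eval_for (Inv : nat -> store -> Prop) i c n s :
  var s 0 = n -> Inv 0 s ->
  (forall k s', k < n -> Inv k s' -> Inv k.+1 (eval c (setv s' i k))) ->
  exists2 s', Inv n s' & eval (CFor i c) s = setv s' i n.
Proof.
move=> vn I0 IS; rewrite /= vn; eexists; last by [].
have gen m s' : m <= n -> Inv (n - m) s' ->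
    Inv n (foldl (fun s1 k => eval c (setv s1 i k)) s' (iota (n - m) m)).
  elim: m s' => [|m IH] s' hm; first by rewrite subn0.
  move=> h /=; have e : (n - m.+1).+1 = n - m by lia.
  by rewrite e; apply: IH (ltnW hm) _; rewrite -e; apply: IS => //; lia.
by have := gen n s (leqnn n); rewrite subnn; apply.
Qed.

(** * Correctness of the compiler *)

Definition usable x := [&& x < nvars, x != scratch1 & x != scratch2].
Definition writable x := (0 < x) && usable x.

(** Variable 0 is never writable, as it bounds the loops. [CRaw x y] asks for [x != y] because the
    compiled code clears [x] before it reads the address in [y]. *)
Fixpoint wf (c : cmd) : bool :=
  match c with
  | CConst x _ => writable x
  | CAdd x y z | CSub x y z => [&& writable x, usable y & usable z]
  | CLoad x k y => [&& writable x, k < 8 & usable y]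
  | CStore k y x => [&& k < 8, usable y & usable x]
  | CRaw x y => [&& writable x, usable y & x != y]
  | CSeq c1 c2 => wf c1 && wf c2
  | CWhen x c => usable x && wf c
  | CFor i c => [&& writable i, wf c & i \notin mods c]
  end.

Lemma wf_mods0 c : wf c -> 0 \notin mods c.
Proof.
elim: c => //= [x m|x y z|x y z|x k y|x y|c1 IH1 c2 IH2|x c IH|i c IH];
  rewrite ?inE ?mem_cat ?negb_or.
- by case/andP; case: x.
- by case/and3P => /andP[]; case: x.
- by case/and3P => /andP[]; case: x.
- by case/and3P => /andP[]; case: x.
- by case/and3P => /andP[]; case: x.
- by case/andP=> /IH1-> /IH2->.
- by case/andP.
- by case/and3P=> /andP[h _] /IH-> _; case: i h.
Qed.

(** The scratch registers are left unconstrained: compiled code overwrites them freely. *)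
Definition rep (R : nat -> nat) (s : store) : Prop :=
  (forall x, usable x -> R x = var s x) /\
  (forall k j, k < 8 -> R (cell k j) = arr s k j).

Definition fetch (p : program) (off : nat) (l : program) :=
  forall i, i < size l -> nth Halt p (off + i) = nth Halt l i.

Lemma fetch_cat p off l1 l2 :
  fetch p off (l1 ++ l2) -> fetch p off l1 /\ fetch p (off + size l1) l2.
Proof.
move=> h; split=> i hi.
  by rewrite h ?nth_cat ?hi // size_cat ltn_addr.
by rewrite -addnA h ?nth_cat ?size_cat ?ltn_add2l // ltnNge leq_addr /= addKn.
Qed.

Lemma fetch_cons p off i l : fetch p off (i :: l) -> nth Halt p off = i /\ fetch p off.+1 l.
Proof.
move=> h; split; first by have := h 0 isT; rewrite addn0.
by move=> j hj; rewrite addSnnS (h j.+1).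
Qed.

#[local] Arguments exec : simpl never.

Lemma exec_add p a b s : exec p (a + b) s = exec p b (exec p a s).
Proof. by rewrite /exec addnC iterD. Qed.

Definition effect (i : instr) (R : nat -> nat) : nat -> nat :=
  match i with
  | Const r c => upd R r c
  | Add r a b => upd R r (R a + R b)
  | Defs.Sub r a b => upd R r (R a - R b)
  | LoadI r a => upd R r (R (R a))
  | StoreI a r => upd R (R a) (R r)
  | _ => R
  end.

Definition straight (i : instr) : bool :=
  match i with Jz _ _ | Halt => false | _ => true end.

Lemma exec_straight p off l R : fetch p off l -> all straight l ->
  exec p (size l) (off, R) = (off + size l, foldl (fun R i => effect i R) R l).
Proof.
elim: l off R => [|i l IH] off R /=; first by rewrite addn0.
case/fetch_cons=> h1 h2 /andP[hi hl]; rewrite -[(size l).+1]add1n exec_add.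
have -> : exec p 1 (off, R) = (off.+1, effect i R) by rewrite /exec /= h1; case: i hi {h1}.
by rewrite IH // add1n addSnnS.
Qed.

Lemma exec_jz p off a t R : nth Halt p off = Jz a t ->
  exec p 1 (off, R) = (if R a == 0 then t else off.+1, R).
Proof. by rewrite /exec /= => ->; case: ifP. Qed.

Lemma cell_eq k j k' j' : k < 8 -> k' < 8 ->
  (cell k j == cell k' j') = (k == k') && (j == j').
Proof. by rewrite /cell /nvars; lia. Qed.

Lemma usable_cell x k j : usable x -> (x == cell k j) = false.
Proof. by rewrite /usable /cell /nvars /scratch1 /scratch2; lia. Qed.

Lemma rep_setv R R' s x v : rep R s -> R' x = v ->
  (forall y, usable y -> y != x -> R' y = R y) ->
  (forall a, nvars <= a -> R' a = R a) -> rep R' (setv s x v).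
Proof.
move=> [h1 h2] hx hy ha; split=> [y uy|k j hk] /=.
  by rewrite /upd; case: (eqVneq y x) => [->|nyx] //; rewrite hy // h1.
by rewrite ha ?h2 // /cell -addnA leq_addr.
Qed.

Lemma compile_straight p off l R R' s' t :
  all straight l -> fetch p off l -> R' = foldl (fun R i => effect i R) R l ->
  size l <= t -> rep R' s' ->
  exists t' R', [/\ t' <= t, exec p t' (off, R) = (off + size l, R') & rep R' s'].
Proof. by move=> h1 h2 -> h3 h4; exists (size l); eexists; rewrite exec_straight. Qed.

Ltac regs := unfold upd, usable, scratch1, scratch2, nvars, cell in *; intros;
  repeat case: eqP; try lia.

Lemma compile_correct c p off R s n :
  wf c -> fetch p off (compile off c) -> rep R s -> var s 0 = n -> 0 < n ->
  exists t R', [/\ t <= cost n c, exec p t (off, R) = (off + size (compile off c), R')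
                & rep R' (eval c s)].
Proof.
elim: c off R s => [x m|x y z|x y z|x k y|k y x|x y|c1 IH1 c2 IH2|x c IH|i c IH] off R s.
- move=> /andP[x0 ux] h hR _ _; apply: (compile_straight _ h erefl) => //=.
  by apply: rep_setv hR _ _ _; intros; rewrite /= /upd; regs.
- move=> /and3P[/andP[x0 ux] uy uz] h hR _ _; apply: (compile_straight _ h erefl) => //=.
  by apply: rep_setv (hR) _ _ _; intros; rewrite /= ?(hR.1 _ uy) ?(hR.1 _ uz); regs.
- move=> /and3P[/andP[x0 ux] uy uz] h hR _ _; apply: (compile_straight _ h erefl) => //=.
  by apply: rep_setv (hR) _ _ _; intros; rewrite /= ?(hR.1 _ uy) ?(hR.1 _ uz); regs.
- move=> /and3P[/andP[x0 ux] k8 uy] h hR _ _; apply: (compile_straight _ h erefl) => //=.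
  have ey := hR.1 _ uy; have ea := hR.2 k (var s y) k8.
  have -> : arr s k (var s y) = R (nvars + k + 8 * R y) by rewrite ey -ea.
  apply: rep_setv (hR) _ _ _; intros; rewrite /= /upd ?eqxx /=.
  + have -> : (R y + R y + (R y + R y) + (R y + R y + (R y + R y)) + (nvars + k)) =
       nvars + k + 8 * R y by lia.
    by regs.
  + by regs.
  + by regs.
- move=> /and3P[k8 uy ux] h hR _ _; apply: (compile_straight _ h erefl) => //=.
  have ey := hR.1 _ uy; have ex := hR.1 _ ux.
  have e8 : R y + R y + (R y + R y) + (R y + R y + (R y + R y)) + (nvars + k) =
       cell k (R y) by rewrite /cell; lia.
  rewrite -ey -ex; split=> [z uz|k' j hk]; rewrite /= /upd /= e8.
  + have uz' := uz; rewrite /usable in uz; case/and3P: uz => _ /negbTE-> /negbTE->.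
    rewrite usable_cell // hR.1 //.
  + rewrite cell_eq // hR.2 //; case: ifP => _.
      by move: ux; rewrite /usable => /and3P[_ /negbTE-> /negbTE->].
    by regs.
- move=> /and3P[/andP[x0 ux] uy nxy] h hR _ _.
  have [h1 h2] := @fetch_cat _ _ [:: _; _; _] [:: _; _] h.
  have [hj h3] := fetch_cons h2; have [hl _] := fetch_cons h3.
  have ey := hR.1 _ uy.
  rewrite /= /raw -ey.
  set R1 := upd (upd (upd R scratch1 nvars.-1) scratch1 (R y - nvars.-1)) x 0.
  have run1 : exec p 3 (off, R) = (off + 3, R1).
    have := exec_straight R h1 isT; rewrite /= => ->; congr (_, _).
    rewrite /R1 {5}/upd eqxx; congr (upd (upd _ _ (_ - _)) _ _).
    by move: uy; regs.
  (* The truncated difference is 0 exactly for an address below [nvars], in which case the jump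
     skips the load. *)
  have R1T : R1 scratch1 = R y - nvars.-1 by rewrite /R1; regs.
  case: (ltnP (R y) nvars) => hy.
  + exists 4, R1; split=> //.
      rewrite -[4]/(3 + 1) exec_add run1 (exec_jz _ hj) R1T.
      by have -> : R y - nvars.-1 = 0 by rewrite /nvars in hy *; lia.
    by apply: rep_setv (hR) _ _ _; rewrite /R1; regs.
  + exists 5, (upd R1 x (R1 (R1 y))); split=> //.
      rewrite -[5]/(3 + (1 + 1)) !exec_add run1 (exec_jz _ hj) R1T.
      have -> : (R y - nvars.-1 == 0) = false by rewrite /nvars in hy *; lia.
      by rewrite /exec /= hl; congr (_, _); lia.
    have R1y : R1 y = R y by rewrite /R1; regs.
    have ea := hR.2 ((R y - nvars) %% 8) ((R y - nvars) %/ 8) (ltn_pmod _ (isT : 0 < 8)).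
    have ec : cell ((R y - nvars) %% 8) ((R y - nvars) %/ 8) = R y.
      by rewrite /cell /nvars in hy *; lia.
    rewrite -ea ec R1y; apply: rep_setv (hR) _ _ _; rewrite /R1; try by regs.
- rewrite /= => /andP[w1 w2] /fetch_cat[h1 h2] hR v0 n0.
  have [t1 [R1 [l1 e1 r1]]] := IH1 off R s w1 h1 hR v0 n0.
  have v1 : var (eval c1 s) 0 = n by rewrite eval_var ?wf_mods0.
  have [t2 [R2 [l2 e2 r2]]] := IH2 _ _ _ w2 h2 r1 v1 n0.
  exists (t1 + t2), R2; split=> //; first by rewrite leq_add.
  by rewrite exec_add e1 e2 size_cat addnA.
- rewrite /= => /andP[ux wc] /fetch_cons[hj h1] hR v0 n0.
  have e1 := exec_jz R hj; rewrite (hR.1 _ ux) in e1.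
  case: eqP e1 => hx e1.
    by exists 1, R; split=> //; rewrite e1 addSnnS.
  have [t1 [R1 [l1 e2 r1]]] := IH off.+1 R s wc h1 hR v0 n0.
  by exists (1 + t1), R1; split=> //; rewrite exec_add e1 e2 addSnnS.
- rewrite /= => /and3P[/andP[i0 ui] wc nic] /fetch_cons[hc /fetch_cat[h1 h2]] hR v0 n0.
  have [h3 h4] := @fetch_cat _ _ [:: _; _; _; _] [:: _] h2.
  have [hj _] := fetch_cons h4.
  set start := off.+1 in h1 h3 h4 hj *.
  set fin := off + _.
  set mid := start + size (compile start c) in h3 h4 hj.
  have fin_mid : fin = mid + 5 by rewrite /fin /= size_cat addnS -addSn addnA.
  have keep0 k s0 : var s0 0 = n -> var (setv s0 i k) 0 = n.
    by rewrite /= /upd; case: (0 =P i) i0 => // <-.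
  (* One pass: the body, the increment of the counter and the test, which leads back to [start] or
     out to [fin]. *)
  have round k R0 s0 : var s0 0 = n -> rep R0 (setv s0 i k) ->
    exists t R', [/\ t <= cost n c + 5,
      exec p t (start, R0) = (if k.+1 < n then start else fin, R')
      & rep R' (setv (eval c (setv s0 i k)) i k.+1)].
    move=> v00 hR0.
    have [t1 [R1 [l1 e1 r1]]] := IH start R0 _ wc h1 hR0 (keep0 _ _ v00) n0.
    set s1 := eval c (setv s0 i k) in r1 *.
    have s1i : var s1 i = k by rewrite eval_var //= /upd eqxx.
    have s10 : var s1 0 = n by rewrite eval_var ?wf_mods0 ?keep0.
    have R1i : R1 i = k by rewrite r1.1.
    have R10 : R1 0 = n by rewrite r1.1.
    have e2 := exec_straight R1 h3 isT.
    set R2 := foldl _ _ _ in e2; rewrite /= in e2.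
    have r2 : rep R2 (setv s1 i k.+1).
      by apply: rep_setv r1 _ _ _; move: ui i0 R1i; rewrite /R2 /=; regs.
    (* By truncation this is 0 exactly when [k.+1 < n], the condition for another pass. *)
    have R2T : R2 scratch1 = k + 2 - n by move: ui i0 R1i R10; rewrite /R2 /=; regs.
    exists (t1 + (4 + 1)), R2; split=> //; first by rewrite leq_add2r.
    rewrite !exec_add e1 -/mid e2 (exec_jz _ hj) R2T; congr (_, _).
    by rewrite fin_mid -addnS; have -> : (k + 2 - n == 0) = (k.+1 < n) by lia.
  have body m k R0 s0 : k + m.+1 = n -> var s0 0 = n -> rep R0 (setv s0 i k) ->
    exists t R', [/\ t <= m.+1 * (cost n c + 5), exec p t (start, R0) = (fin, R')
      & rep R' (setv (foldl (fun s' k => eval c (setv s' i k)) s0 (iota k m.+1)) i n)].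
    elim: m k R0 s0 => [|m IHm] k R0 s0 ekm v00 hR0;
      have [t [R2 [l e2 r2]]] := round k R0 s0 v00 hR0.
      exists t, R2; rewrite mul1n; split=> //; last by rewrite -ekm addn1.
      by rewrite e2 ifN //; lia.
    have v1 : var (eval c (setv s0 i k)) 0 = n by rewrite eval_var ?wf_mods0 ?keep0.
    have [t' [R' [l' e' r']]] := IHm k.+1 R2 _ ltac:(lia) v1 r2.
    exists (t + t'), R'; split=> //; first by rewrite mulSn leq_add.
    by rewrite exec_add e2 ifT ?e' //; lia.
  have [t [R' [lt et rt]]] := body n.-1 0 (upd R i 0) s ltac:(lia) v0 ltac:(by
    apply: rep_setv hR _ _ _; regs).
  exists (1 + t), R'; split.
  + by rewrite prednK in lt; rewrite //= add1n ltnS.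
  + by rewrite exec_add /exec /= hc -/(exec _ _ _) et.
  + by rewrite /= v0; rewrite prednK in rt.
Qed.

(** * Breadth-first search *)

Section Search.
Variables (n : nat) (e : rel nat).
Hypotheses (e_sym : symmetric e) (e_irr : irreflexive e)
  (e_lt : forall x y, e x y -> x < n /\ y < n).
Variables a r b : nat.

Definition allowed v := (v < n) && [|| ~~ e r v, v == a | v == b].

(** [D] is the level plus one, so that 0 means unreached. [q] keeps every vertex ever queued, and
    its first [h] entries have been expanded; [h] may run past the end of [q]. *)
Record search_inv (D P : nat -> nat) (q : seq nat) (h : nat) : Prop := SearchInv {
  si_uniq : uniq q;
  si_allowed : {subset q <= allowed};
  si_root : 0 < size q /\ nth 0 q 0 = r;
  si_rootD : D r = 1;
  si_D : forall v, v < n -> (0 < D v) = (v \in q);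
  si_parent : forall v, v \in q -> v != r ->
    [/\ P v \in q, e (P v) v & D v = (D (P v)).+1];
  si_mono : forall i j, i <= j -> j < size q -> D (nth 0 q i) <= D (nth 0 q j);
  si_span : forall i j, h <= i -> i < size q -> j < size q ->
    D (nth 0 q j) <= (D (nth 0 q i)).+1;
  si_done : forall i y, i < h -> i < size q -> allowed y -> e (nth 0 q i) y ->
    y \in q /\ D y <= (D (nth 0 q i)).+1 }.

(** By [si_span] no queued vertex is deeper than the new one, so the queue stays sorted by level. *)
Lemma search_push D P q h y : search_inv D P q h -> h < size q -> allowed y ->
  e (nth 0 q h) y -> y \notin q ->
  search_inv (upd D y (D (nth 0 q h)).+1) (upd P y (nth 0 q h)) (rcons q y) h.
Proof.
move=> [s1 s2 [s3 s3'] s4 s5 s6 s7 s8 s9] hq ay ey nyq.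
set u := nth 0 q h.
have uq : u \in q by apply: mem_nth.
have nD v : v \in q -> upd D y (D u).+1 v = D v.
  by rewrite /upd; case: eqP => // -> h'; rewrite h' in nyq.
have nP v : v \in q -> upd P y u v = P v.
  by rewrite /upd; case: eqP => // -> h'; rewrite h' in nyq.
have yD : upd D y (D u).+1 y = (D u).+1 by rewrite /upd eqxx.
have rq : r \in q by rewrite -s3' mem_nth.
have nth_old i : i < size q -> nth 0 (rcons q y) i = nth 0 q i.
  by move=> hi; rewrite nth_rcons hi.
have nth_new : nth 0 (rcons q y) (size q) = y by rewrite nth_rcons ltnn eqxx.
have caseS i : i < (size q).+1 -> i < size q \/ i = size q by lia.
have Dq i : i < size q -> upd D y (D u).+1 (nth 0 (rcons q y) i) = D (nth 0 q i).
  by move=> hi; rewrite nth_old // nD // mem_nth.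
have Dnew : upd D y (D u).+1 (nth 0 (rcons q y) (size q)) = (D u).+1 by rewrite nth_new.
split.
- by rewrite rcons_uniq nyq.
- by move=> v; rewrite mem_rcons inE => /predU1P[->|/s2].
- by rewrite size_rcons nth_old.
- by rewrite nD.
- move=> v vn; rewrite mem_rcons inE; case: eqP => [->|nvy]; first by rewrite yD.
  by rewrite /upd; case: eqP => //= _; apply: s5.
- move=> v; rewrite mem_rcons inE => /predU1P[-> _|vq vr].
    have yP : upd P y u y = u by rewrite /upd eqxx.
    by rewrite yP yD mem_rcons inE uq orbT nD.
  have [p1 p2 p3] := s6 v vq vr.
  by rewrite nP // !nD // mem_rcons inE p1 orbT.
- move=> i j ij; rewrite size_rcons => /caseS[hj|hj].
    by rewrite !Dq //; [apply: s7 | apply: leq_ltn_trans hj].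
  rewrite hj Dnew; have [hi|hi] := caseS i ltac:(lia).
    by rewrite Dq //; apply: s8.
  by rewrite hi Dnew.
- move=> i j hi; rewrite size_rcons => /caseS[hi'|hi'] /caseS[hj|hj].
  + by rewrite !Dq //; apply: s8.
  + by rewrite hj Dnew Dq // ltnS; apply: s7.
  + rewrite hi' Dnew Dq //; apply: leqW; exact: s8.
  + by rewrite hi' hj Dnew.
- move=> i x ih _ ax; rewrite nth_old; last by apply: ltn_trans hq.
  move=> ex; have [h1 h2] := s9 i x ih (ltn_trans ih hq) ax ex.
  by rewrite mem_rcons inE h1 orbT !nD // mem_nth // (ltn_trans ih).
Qed.

Lemma search_next D P q h : search_inv D P q h ->
  (h < size q -> forall y, allowed y -> e (nth 0 q h) y -> y \in q) ->
  search_inv D P q h.+1.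
Proof.
move=> [s1 s2 s3 s4 s5 s6 s7 s8 s9] hall; split=> //.
  by move=> i j hi; apply: s8; apply: ltnW.
move=> i y; rewrite ltnS leq_eqVlt => /predU1P[->|hi] iq ay ey; last exact: s9.
have yq := hall iq y ay ey; split=> //.
by move: (yq) => /(nthP 0)[j hj <-]; apply: s8.
Qed.

(** The queue has at most [n] entries, so all of them have been expanded. Vertices of level 1 are
    allowed neighbours of [r], hence [a] or [b]. *)
Lemma search_layering D P q h : ~~ e a b -> search_inv D P q h -> n <= h ->
  layering e (mem q) r (fun v => (D v).-1) P.
Proof.
move=> nab [s1 s2 [s3 s3'] s4 s5 s6 s7 s8 s9] nh.
have qn v : v \in q -> v < n by move/s2 => /andP[].
have sq : size q <= n.
  rewrite -(size_iota 0 n); apply: uniq_leq_size => // v /qn.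
  by rewrite mem_iota.
have rq : r \in q by rewrite -s3' mem_nth.
have Dpos v : v \in q -> 0 < D v by move=> vq; rewrite s5 // qn.
split=> //.
- by rewrite s4.
- move=> v vq vr; have [p1 p2 p3] := s6 v vq vr.
  by split=> //; have := Dpos _ p1; lia.
- move=> u v uq vq euv; have /(nthP 0)[i hi ei] := uq.
  have [|_] := s9 i v (leq_trans hi (leq_trans sq nh)) hi (s2 _ vq); first by rewrite ei.
  by rewrite ei; have := Dpos _ uq; lia.
- have par_r v : v \in q -> (D v).-1 = 1 -> e r v.
    move=> vq Dv; have nvr : v != r by apply: contra_eqN Dv => /eqP->; rewrite s4.
    have [p1 p2 p3] := s6 v vq nvr.
    suff -> : r = P v by [].
    apply/eqP/negPn/negP; rewrite eq_sym => pr; have [p4 p5 p6] := s6 _ p1 pr.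
    by have := Dpos _ p4; lia.
  have ab v : v \in q -> (D v).-1 = 1 -> (v == a) || (v == b).
    by move=> vq Dv; have /andP[_] := s2 v vq; rewrite par_r.
  move=> u v uq vq Du Dv.
  case/orP: (ab u uq Du) => /eqP->; case/orP: (ab v vq Dv) => /eqP->; rewrite ?e_irr //.
  by rewrite e_sym.
Qed.

Definition flat_fail (D P : nat -> nat) u v :=
  [&& 0 < D u, e u v, D u == D v, ~~ e (P u) v & ~~ e (P v) u].

Lemma flat_fail_sound D P q h u v : no_bull e -> ~~ e a b -> search_inv D P q h ->
  n <= h -> flat_fail D P u v -> exists a b c, hole_through e a b c.
Proof.
move=> nb nab si nh /and5P[Du euv /eqP Duv pu pv].
have [un vn] := e_lt euv.
apply: (flat_edge_hole e_sym e_irr nb (search_layering nab si nh) (u := u) (v := v)) => //.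
- by rewrite /= -(si_D si).
- by rewrite /= -(si_D si) // -Duv.
- by rewrite Duv.
Qed.

(** All vertices of the hole are allowed, since its only neighbours of [r] are [a] and [b].
    Induction along the hole shows that they are all reached, and [no_hole_through] applies if no
    edge fails. *)
Lemma flat_fail_complete D P q h : no_bull e -> ~~ e a b -> search_inv D P q h ->
  n <= h -> hole_through e a r b -> exists u v, flat_fail D P u v.
Proof.
move=> nb nab si nh [k [c [k5 kodd hc [c0 c1 ck]]]].
have lay := search_layering nab si nh.
have qn v : v \in q -> v < n by move/(si_allowed si) => /andP[].
case: (boolP (has (fun u => has (flat_fail D P u) (iota 0 n)) (iota 0 n))).
  by case/hasP=> u _ /hasP[v _ huv]; exists u, v.
move=> nofail; exfalso.
apply: (no_hole_through e_sym e_irr nb lay _ k5 kodd hc c0) => [u v uq vq euv Duv|i].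
  apply/negPn/negP; rewrite negb_or => /andP[h1 h2]; case/hasP: nofail.
  have [un vn] := e_lt euv.
  exists u; first by rewrite mem_iota.
  apply/hasP; exists v; first by rewrite mem_iota.
  have Du : 0 < D u by rewrite (si_D si).
  have Dv : 0 < D v by rewrite (si_D si).
  by rewrite /flat_fail Du euv h1 h2 !andbT /=; apply/eqP; lia.
elim: i => [|i IH] ik; first by rewrite c0; apply: (lay_root lay).
have ci := IH (ltnW ik).
have ee : e (c i) (c i.+1) by rewrite hc // eqxx.
have /(nthP 0)[j hj ej] := ci.
have sq : size q <= n.
  rewrite -(size_iota 0 n); apply: uniq_leq_size; first exact: si_uniq si.
  by move=> v /qn; rewrite mem_iota.
have al : allowed (c i.+1).
  rewrite /allowed (e_lt ee).2 -c0 hc //= -ck -c1.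
  case: (eqVneq i.+1 1) => [->|i1]; first by rewrite eqxx orbT.
  case: (eqVneq i.+1 k.-1) => [->|ik1]; first by rewrite eqxx !orbT.
  by [].
by have [] := si_done si (leq_trans hj (leq_trans sq nh)) hj al; rewrite ?ej.
Qed.

End Search.

(** * The detection program *)

Local Notation vN := 0 (only parsing).
Local Notation vPACK := 1 (only parsing).
Local Notation vRES := 4 (only parsing).
Local Notation vONE := 5 (only parsing).
Local Notation vACC := 6 (only parsing).
Local Notation vA := 7 (only parsing).
Local Notation vR := 8 (only parsing).
Local Notation vB := 9 (only parsing).
Local Notation vU := 10 (only parsing).
Local Notation vV := 11 (only parsing).
Local Notation vHEAD := 12 (only parsing).
Local Notation vTAIL := 13 (only parsing).
Local Notation vDU := 14 (only parsing).
Local Notation t1 := 15 (only parsing).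
Local Notation t2 := 16 (only parsing).
Local Notation t3 := 17 (only parsing).

Local Notation aADJ := 0 (only parsing).
Local Notation aROW := 1 (only parsing).
Local Notation aNEW := 2 (only parsing).
Local Notation aDIST := 3 (only parsing).
Local Notation aPAR := 4 (only parsing).
Local Notation aQUEUE := 5 (only parsing).

(** The RAM has no multiplication, so the products [x * n] are tabulated in [aROW]. *)
Definition adjq t x y := CLoad t aROW x ;; CAdd t t y ;; CLoad t aADJ t.

(** [aNEW] marks the allowed vertices not yet queued. The entry of [r] is cleared after those of [a]
    and [b] are set, so it ends at 0 even if [r] equals one of them. *)
Definition reset :=
  CFor vV (adjq t1 vR vV ;; CSub t1 vONE t1 ;; CStore aNEW vV t1 ;;
           CConst t1 0 ;; CStore aDIST vV t1) ;;
  CConst t1 1 ;; CStore aNEW vA t1 ;; CStore aNEW vB t1 ;; CStore aDIST vR t1 ;;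
  CConst vTAIL 0 ;; CStore aNEW vR vTAIL ;; CStore aQUEUE vTAIL vR ;; CConst vTAIL 1.

Definition visit :=
  adjq t1 vU vV ;;
  CWhen t1 (CLoad t1 aNEW vV ;;
    CWhen t1 (CConst t1 0 ;; CStore aNEW vV t1 ;; CStore aDIST vV vDU ;;
      CStore aPAR vV vU ;; CStore aQUEUE vTAIL vV ;; CAdd vTAIL vTAIL vONE)).

Definition bfs :=
  CFor vHEAD (CSub t1 vTAIL vHEAD ;;
    CWhen t1 (CLoad vU aQUEUE vHEAD ;; CLoad vDU aDIST vU ;; CAdd vDU vDU vONE ;;
      CFor vV visit)).

(** Subtraction from 1 tests for zero: first the sum of the two truncated differences of levels,
    then the sum of the two parent adjacency bits. *)
Definition test_edge :=
  adjq t1 vU vV ;;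
  CWhen t1 (CLoad t1 aDIST vV ;; CSub t2 t1 vDU ;; CSub t1 vDU t1 ;; CAdd t1 t1 t2 ;;
    CSub t1 vONE t1 ;;
    CWhen t1 (CLoad t2 aPAR vU ;; adjq t1 t2 vV ;; CLoad t3 aPAR vV ;; adjq t2 t3 vU ;;
      CAdd t1 t1 t2 ;; CSub t1 vONE t1 ;; CWhen t1 (CConst vRES 1))).

Definition check_levels :=
  CFor vU (CLoad vDU aDIST vU ;; CWhen vDU (CFor vV test_edge)).

Definition triple :=
  adjq t1 vA vB ;; CSub t1 vONE t1 ;; CWhen t1 (reset ;; bfs ;; check_levels).

Definition detect := CFor vA (CFor vR (CFor vB triple)).

Lemma eval_seq c1 c2 s : eval (c1 ;; c2) s = eval c2 (eval c1 s).
Proof. by []. Qed.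

Lemma eval_when x c s : eval (CWhen x c) s = if var s x == 0 then s else eval c s.
Proof. by []. Qed.

Lemma setv_setv s x v w : setv (setv s x v) x w = setv s x w.
Proof.
rewrite /setv /=; congr Store; apply: functional_extensionality => y.
by rewrite /upd; case: eqP.
Qed.

#[local] Arguments upd _ _ _ _ /.

(** * Correctness of the detection program *)

Section Detect.
Variables (n : nat) (e : rel nat).

Record prepared (s : store) : Prop := Prepared {
  pr_n : var s vN = n;
  pr_one : var s vONE = 1;
  pr_row : forall x, x < n -> arr s aROW x = x * n;
  pr_adj : forall x y, x < n -> y < n -> arr s aADJ (x * n + y) = e x y }.

Lemma prepared_eval c s :
  [&& vN \notin mods c, vONE \notin mods c, aADJ \notin amods c & aROW \notin amods c] ->
  prepared s -> prepared (eval c s).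
Proof.
by case/and4P=> h1 h2 h3 h4 [p1 p2 p3 p4]; split; rewrite ?eval_var ?eval_arr.
Qed.

Lemma prepared_setv s x v : (vN != x) && (vONE != x) -> prepared s -> prepared (setv s x v).
Proof.
by case/andP=> /negbTE h1 /negbTE h2 [p1 p2 p3 p4]; split; rewrite /= /upd ?h1 ?h2.
Qed.

Lemma eval_adjq s t x y : t != y -> prepared s -> var s x < n -> var s y < n ->
  eval (adjq t x y) s = setv s t (e (var s x) (var s y)).
Proof.
move=> ty ps xn yn; rewrite /adjq !eval_seq /= !setv_setv; congr setv.
by rewrite /upd eqxx eq_sym (negbTE ty) (pr_row ps) // (pr_adj ps).
Qed.

Hypotheses (e_sym : symmetric e) (e_irr : irreflexive e)
  (e_lt : forall x y, e x y -> x < n /\ y < n) (nb : no_bull e).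

Section Triple.
Variables a r b : nat.

Definition at_triple s := [/\ prepared s, var s vA = a, var s vR = r & var s vB = b].

Definition searched (s : store) (q : seq nat) (h : nat) : Prop :=
  [/\ search_inv n e a r b (arr s aDIST) (arr s aPAR) q h,
      var s vTAIL = size q,
      forall i, i < size q -> arr s aQUEUE i = nth 0 q i
    & forall v, v < n -> (0 < arr s aNEW v) = allowed n e a r b v && (v \notin q)].

Lemma reset_correct s : r < n -> at_triple s ->
  prepared (eval reset s) /\ searched (eval reset s) [:: r] 0.
Proof.
move=> rn [ps sa sr sb]; split; first exact: prepared_eval.
rewrite /reset eval_seq.
set body := (X in CFor vV X).
pose Inv k s' := [/\ at_triple s', forall v, v < k -> arr s' aNEW v = ~~ e r v
  & forall v, v < k -> arr s' aDIST v = 0].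
have [||s' [[ps' sa' sr' sb'] hN hD] ->] := @eval_for Inv vV body n s (pr_n ps).
- by [].
- move=> k s' kn [[ps' sa' sr' sb'] hN hD].
  have h : eval body (setv s' vV k) = seta (seta
      (setv (setv (setv (setv s' vV k) t1 (e r k)) t1 (1 - e r k)) t1 0) aNEW k (1 - e r k)) aDIST k 0.
    rewrite /body eval_seq eval_adjq //=; [|exact: prepared_setv|by rewrite sr'].
    by rewrite sr' (pr_one ps').
  rewrite h; split.
  + by split; rewrite //= -?h; apply: prepared_eval => //; apply: prepared_setv.
  + move=> v; rewrite ltnS leq_eqVlt /= => /predU1P[->|vk]; first by rewrite eqxx; case: e.
    by rewrite ltn_eqF // hN.
  + move=> v; rewrite ltnS leq_eqVlt /= => /predU1P[->|vk]; first by rewrite eqxx.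
    by rewrite ltn_eqF // hD.
rewrite /= sa' sr' sb'; split=> //=.
- split=> //=; rewrite ?eqxx //.
  + by move=> v; rewrite inE => /eqP->; rewrite /in_mem /= /allowed rn e_irr.
  + by move=> v vn; rewrite inE; case: eqP => //; rewrite hD.
  + by move=> v; rewrite inE => /eqP->; rewrite eqxx.
  + by move=> [|i] [|j].
  + by move=> [|i] [|j].
- by case.
- move=> v vn; rewrite /allowed vn inE.
  case: (v =P r) => _; rewrite ?andbF ?andbT //.
  case: (v =P b) => _; rewrite ?orbT ?orbF //.
  by case: (v =P a) => _; rewrite ?orbT ?orbF // hN //; case: e.
Qed.

(** The queue may grow, but its head and the level of the head are kept, so the inner loop can go on
    with the same [vU] and [vDU]. *)
Lemma visit_correct s q h k : prepared s -> searched s q h -> h < size q -> k < n ->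
  var s vU = nth 0 q h -> var s vDU = (arr s aDIST (nth 0 q h)).+1 -> var s vV = k ->
  let s' := eval visit s in
  exists q', searched s' q' h /\ [/\ h < size q', nth 0 q' h = nth 0 q h,
    arr s' aDIST (nth 0 q h) = arr s aDIST (nth 0 q h), {subset q <= q'}
    & allowed n e a r b k -> e (nth 0 q h) k -> k \in q'].
Proof.
set u := nth 0 q h => ps [si hT hQ hN] hq kn su sdu sv s'.
have uq : u \in q by apply: mem_nth.
have un : u < n by have /andP[] := si_allowed si uq.
have skip : arr s' = arr s -> var s' vTAIL = var s vTAIL ->
    (allowed n e a r b k -> e u k -> k \in q) ->
    exists q', searched s' q' h /\ [/\ h < size q', nth 0 q' h = u,
    arr s' aDIST u = arr s aDIST u, {subset q <= q'}
    & allowed n e a r b k -> e u k -> k \in q'].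
  by move=> h1 h2 h3; exists q; split; split; rewrite ?h1 ?h2.
move: @s' skip; rewrite /visit eval_seq eval_adjq ?su ?sv //.
set s1 := setv _ _ _; rewrite eval_when {1}/s1 /=.
case euk: (e u k) => /= skip; last by apply: skip.
move: skip; rewrite sv; case: posnP (hN k kn) => hk /= hN' skip.
  by apply: skip => // ak _; move: hN'; rewrite ak /=; case: (k \in q).
move: hN' => /esym/andP[ak nkq]; rewrite -/u in sdu euk.
have nku : (u == k) = false by apply/negP => /eqP ek; rewrite -ek uq in nkq.
have si' := search_push si hq ak euk nkq; rewrite -/u in si'.
exists (rcons q k); split; split=> /=.
- by rewrite su sdu.
- by rewrite hT (pr_one ps) size_rcons addn1.
- move=> i; rewrite size_rcons ltnS nth_rcons hT => iq.
  by case: ltngtP iq => // iq' _; rewrite hQ.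
- move=> v vn; rewrite mem_rcons inE.
  by case: (v =P k) => [->|_] /=; rewrite ?andbF // hN.
- by rewrite size_rcons ltnW.
- by rewrite nth_rcons hq.
- by rewrite nku.
- by move=> v vq; rewrite mem_rcons inE vq orbT.
- by rewrite mem_rcons inE eqxx.
Qed.

Lemma bfs_correct s : prepared s -> searched s [:: r] 0 ->
  exists q, searched (eval bfs s) q n.
Proof.
move=> ps hs; rewrite /bfs.
set body := (X in CFor vHEAD X).
pose Inv k s' := prepared s' /\ exists q, searched s' q k.
have [||s' [ps' [q hq]] ->] := @eval_for Inv vHEAD body n s (pr_n ps); last first.
- by exists q; case: hq.
- move=> k s' kn [ps' [q hq]]; split.
    by apply: prepared_eval => //; apply: prepared_setv.
  have [si hT hQ hN] := hq.
  set s0 := setv (setv s' vHEAD k) t1 (size q - k).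
  set s1 := eval (CLoad vU aQUEUE vHEAD ;; CLoad vDU aDIST vU ;; CAdd vDU vDU vONE) s0.
  have -> : eval body (setv s' vHEAD k) =
      if size q - k == 0 then s0 else eval (CFor vV visit) s1.
    by rewrite /body eval_seq eval_when /s1 /s0 !eval_seq /= hT.
  case: leqP (subn_eq0 (size q) k) => hk ->.
    exists q; split=> //; apply: search_next (si) _ => hk'.
    by rewrite ltnNge hk in hk'.
  have uq : nth 0 q k \in q by apply: mem_nth.
  have s1u : var s1 vU = nth 0 q k by rewrite /s1 /= hQ.
  have s1d : var s1 vDU = (arr s1 aDIST (nth 0 q k)).+1.
    by rewrite /s1 /= hQ // (pr_one ps') addn1.
  have ps1 : prepared s1 by do !apply: prepared_setv => //.
  have hs1 : searched s1 q k by split.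
  (* Invariant of the inner loop: the allowed neighbours of the head that are smaller than [y] have
     been queued. *)
  pose J y s2 := [/\ prepared s2, var s2 vU = nth 0 q k &
    exists q', searched s2 q' k /\ [/\ k < size q', nth 0 q' k = nth 0 q k,
      var s2 vDU = (arr s2 aDIST (nth 0 q k)).+1
      & forall x, x < y -> allowed n e a r b x -> e (nth 0 q k) x -> x \in q']].
  have [||s2 [ps2 su2 [q2 [hs2 [hk2 hn2 hd2 hx2]]]]] := @eval_for J vV visit n s1 (pr_n ps1).
  + by split=> //; exists q; split.
  + move=> y s2 yn [ps2 su2 [q2 [hs2 [hk2 hn2 hd2 hx2]]]].
    have ps2' : prepared (setv s2 vV y) by apply: prepared_setv.
    have hs2' : searched (setv s2 vV y) q2 k by case: hs2.
    have [] := visit_correct ps2' hs2' hk2 yn _ _ erefl; rewrite ?hn2 //.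
    move=> q3 [hs3 [hk3 hn3 hd3 sub3 hy3]].
    split; [exact: prepared_eval|by rewrite eval_var|].
    exists q3; split=> //; split=> //.
    - by rewrite eval_var // hd3.
    - move=> x; rewrite ltnS leq_eqVlt => /predU1P[->|xy] // ax ex.
      exact/sub3/hx2.
  + move=> ->; case: hs2 => si2 hT2 hQ2 hN2.
    exists q2; split=> //.
    apply: search_next si2 _ => _ x ax; rewrite hn2; apply: hx2 => //.
    by case/andP: ax.
- by split=> //; exists [:: r].
Qed.

Lemma test_edge_correct s u v : prepared s -> u < n -> v < n -> var s vU = u -> var s vV = v ->
  var s vDU = arr s aDIST u -> 0 < arr s aDIST u ->
  (e u v -> arr s aDIST u = arr s aDIST v -> arr s aPAR u < n /\ arr s aPAR v < n) ->
  var (eval test_edge s) vRES =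
    if flat_fail e (arr s aDIST) (arr s aPAR) u v then 1 else var s vRES.
Proof.
move=> ps un vn su sv sd Du hP; rewrite /test_edge eval_seq eval_adjq ?su ?sv //.
set inner := (X in CWhen t1 X).
rewrite eval_when /flat_fail Du; set s1 := setv s _ _.
have s1t : var s1 t1 = e u v by [].
rewrite s1t; case euv: (e u v) hP => // hP.
rewrite (_ : (nat_of_bool true == 0) = false) //.
set D := arr s aDIST in sd Du hP *; set P := arr s aPAR in hP *.
have ps1 : prepared s1 by apply: prepared_setv.
rewrite /inner !eval_seq.
set s2 := eval (CSub t1 vONE t1) _; set inner2 := (X in CWhen t1 X).
have ps2 : prepared s2 by do !apply: prepared_eval => //.
have as2 : arr s2 = arr s by [].
have s2t : var s2 t1 = 1 - (D u - D v + (D v - D u)).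
  by rewrite /s2 /= sv sd (pr_one ps) -/D addnC.
have s2res : var s2 vRES = var s vRES by [].
have s2u : var s2 vU = u by [].
have s2v : var s2 vV = v by [].
move: s2 ps2 as2 s2t s2res s2u s2v => s2 ps2 as2 s2t s2res s2u s2v.
rewrite eval_when s2t; case: (eqVneq (D u) (D v)) => [Duv|nDuv]; last first.
  have -> : 1 - (D u - D v + (D v - D u)) = 0 by lia.
  by rewrite eqxx.
have -> : 1 - (D u - D v + (D v - D u)) = 1 by lia.
rewrite (_ : (1 == 0) = false) //.
have [pu pv] := hP isT Duv.
rewrite /inner2 2!eval_seq.
set s3 := eval (adjq t1 t2 vV) _.
have es3 : s3 = setv (setv s2 t2 (P u)) t1 (e (P u) v).
  rewrite /s3 eval_adjq //=; rewrite ?as2 ?s2u ?s2v //; exact: prepared_setv.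
rewrite 2!eval_seq; set s4 := eval (adjq t2 t3 vU) _.
have es4 : s4 = setv (setv s3 t3 (P v)) t2 (e (P v) u).
  rewrite /s4 es3 eval_adjq //=; rewrite ?as2 ?s2u ?s2v //.
  by do 3 apply: prepared_setv => //.
by rewrite es4 es3 /= (pr_one ps2) /=; do 2 case: e; rewrite /= ?s2res.
Qed.

Lemma check_levels_correct s q : ~~ e a b -> prepared s -> searched s q n ->
  (forall u v, u < n -> v < n -> flat_fail e (arr s aDIST) (arr s aPAR) u v ->
     var (eval check_levels s) vRES != 0) /\
  (var s vRES != 0 -> var (eval check_levels s) vRES != 0) /\
  (var (eval check_levels s) vRES != 0 -> var s vRES != 0 \/
     exists u v, flat_fail e (arr s aDIST) (arr s aPAR) u v).
Proof.
move=> nab ps [si _ _ _]; set D := arr s aDIST; set P := arr s aPAR.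
have lay := search_layering e_sym e_irr nab si (leqnn n).
have qn v : v \in q -> v < n by move/(si_allowed si) => /andP[].
(* [aPAR] is not reset, so its entry at [r] is arbitrary. A flat edge avoids [r], the only vertex of
   level 0, hence both parents are queued vertices. *)
have Pn u v : 0 < D u -> e u v -> D u = D v -> P u < n /\ P v < n.
  move=> Du euv Duv; have [un vn] := e_lt euv.
  have uq : u \in q by rewrite -(si_D si).
  have vq : v \in q by rewrite -(si_D si) // -/D -Duv.
  have rooted x y : x \in q -> y \in q -> e x y -> D x = D y -> x != r.
    move=> xq yq exy Dxy; apply/eqP => xr; subst x.
    case: (eqVneq y r) => [yr|ynr]; first by rewrite yr e_irr in exy.
    have [p1 p2 p3] := si_parent si yq ynr.
    have : 0 < D (P y) by rewrite (si_D si) // qn.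
    by have := si_rootD si; move: p3; rewrite -/D -/P; lia.
  split; apply: qn.
    by have [] := si_parent si uq (rooted u v uq vq euv Duv).
  by have [] := si_parent si vq (rooted v u vq uq ltac:(by rewrite e_sym) (esym Duv)).
pose res := var s vRES.
(* [A] stands for the pairs tested so far. *)
pose Found (A : nat -> nat -> bool) s' :=
  [/\ prepared s', arr s' = arr s, res != 0 -> var s' vRES != 0,
    var s' vRES != 0 -> res != 0 \/ exists u v, flat_fail e D P u v
  & forall u v, A u v -> v < n -> flat_fail e D P u v -> var s' vRES != 0].
rewrite /check_levels; set body := (X in CFor vU X).
have [||s' [ps' as' h1 h2 h3] ->] :=
  @eval_for (fun k => Found (fun u _ => u < k)) vU body n s (pr_n ps).
- by split=> //; left.
- move=> u s' un [ps' as' h1 h2 h3].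
  set s0 := setv s' vU u.
  have ps0 : prepared s0 by apply: prepared_setv.
  rewrite /body eval_seq; set s1 := eval _ s0.
  have ps1 : prepared s1 by apply: prepared_eval.
  have s1d : var s1 vDU = D u by rewrite /s1 /s0 /= as'.
  have s1a : arr s1 = arr s by [].
  have s1r : var s1 vRES = var s' vRES by [].
  have s1u : var s1 vU = u by [].
  move: s1 ps1 s1d s1a s1r s1u => s1 ps1 s1d s1a s1r s1u.
  rewrite eval_when s1d; case: posnP => Du.
    split; rewrite ?s1r //.
    move=> x y; rewrite ltnS leq_eqVlt => /predU1P[->|xu] yn; last exact: h3.
    by rewrite /flat_fail Du.
  have [||s2 [[ps2 as2 g1 g2 g3] [s2u s2d]] ->] :=
    @eval_for (fun k s2 => Found (fun x y => (x < u) || (x == u) && (y < k)) s2 /\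
      var s2 vU = u /\ var s2 vDU = D u) vV test_edge n s1 (pr_n ps1).
  + do !split => //; rewrite ?s1r //.
    by move=> x y; rewrite andbF orbF; apply: h3.
  + move=> v s2 vn [[ps2 as2 g1 g2 g3] [s2u s2d]].
    have ps2' : prepared (setv s2 vV v) by apply: prepared_setv.
    have tc : var (eval test_edge (setv s2 vV v)) vRES =
        if flat_fail e D P u v then 1 else var s2 vRES.
      have := @test_edge_correct (setv s2 vV v) u v ps2' un vn s2u erefl.
      by rewrite /= as2; apply=> //; apply: Pn.
    split; last by rewrite !eval_var.
    split.
    * exact: prepared_eval.
    * by apply: functional_extensionality => j; rewrite eval_arr //= as2.
    * by rewrite tc; case: ifP => // _; apply: g1.
    * by rewrite tc; case: ifP => [h _|_]; [right; exists u, v | apply: g2].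
    * move=> x y hxy yn hf; rewrite tc.
      case: ifP => [//|nf]; apply: (g3 x y) => //.
      case/orP: hxy => [->//|/andP[/eqP ex]]; rewrite ltnS leq_eqVlt ex eqxx.
      by case/predU1P=> [ey|->]; rewrite ?orbT //; rewrite -ex -ey hf in nf.
  + split=> //; first exact: prepared_setv.
    move=> x y; rewrite ltnS leq_eqVlt => /predU1P[->|xu] yn; apply: g3 => //.
      by rewrite eqxx yn orbT.
    by rewrite xu.
- split=> [u v un vn|]; first exact: h3.
  by split.
Qed.

End Triple.

(** The two directions are asymmetric: a hole through the given triple is always detected, while a
    detection yields a hole that may pass elsewhere. *)
Lemma triple_correct a r b s : a < n -> r < n -> b < n -> at_triple a r b s ->
  [/\ prepared (eval triple s), var s vRES != 0 -> var (eval triple s) vRES != 0,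
      var (eval triple s) vRES != 0 -> var s vRES != 0 \/
        exists a b c, hole_through e a b c
    & hole_through e a r b -> var (eval triple s) vRES != 0].
Proof.
move=> an rn bn [ps sa sr sb].
have pt : prepared (eval triple s) by apply: prepared_eval.
suff [h1 h2 h3] : [/\ var s vRES != 0 -> var (eval triple s) vRES != 0,
      var (eval triple s) vRES != 0 -> var s vRES != 0 \/
        exists a b c, hole_through e a b c
    & hole_through e a r b -> var (eval triple s) vRES != 0] by [].
clear pt; have [s' es'] : exists s', eval triple s = s' by eexists.
rewrite es'; move: es'; rewrite /triple eval_seq eval_adjq ?sa ?sb // eval_seq.
set s1 := eval (CSub _ _ _) _.
have ps1 : prepared s1 by do !apply: prepared_setv => //.
have at1 : at_triple a r b s1 by split.
have r1 : var s1 vRES = var s vRES by [].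
rewrite eval_when; have -> : var s1 t1 = ~~ e a b by rewrite /s1 /= (pr_one ps); case: e.
move: s1 ps1 at1 r1 => s1 ps1 at1 r1.
(* For adjacent [a] and [b] nothing is run, and no hole has both as its neighbours of [r]. *)
case: (boolP (e a b)) => nab.
  rewrite (_ : (nat_of_bool (~~ true) == 0) = true) // => <-.
  split; rewrite ?r1 //; first by left.
  case=> k [c [k5 _ hc [_ c1 ck]]]; move: nab.
  by rewrite -c1 -ck hc; lia.
rewrite (_ : (nat_of_bool (~~ false) == 0) = false) // 2!eval_seq.
have [ps2 hs2] := reset_correct rn at1.
have [q hs3] := bfs_correct ps2 hs2.
have ps3 : prepared (eval bfs (eval reset s1)) by apply: prepared_eval.
have [c1 [c2 c3]] := check_levels_correct nab ps3 hs3.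
have r3 : var (eval bfs (eval reset s1)) vRES = var s vRES by rewrite !eval_var.
have [si _ _ _] := hs3.
move=> <-; split.
- by rewrite -r3.
- case/c3 => [|[u [v h]]]; [by rewrite r3; left | right].
  exact: (flat_fail_sound e_sym e_irr e_lt nb nab si (leqnn n) h).
- move=> ht; have [u [v h]] := flat_fail_complete e_sym e_irr e_lt nb nab si (leqnn n) ht.
  have [un vn] : u < n /\ v < n by case/and5P: h => _ /e_lt.
  exact: c1 h.
Qed.

Lemma detect_correct s : prepared s -> var s vRES = 0 ->
  var (eval detect s) vRES != 0 <-> exists a r b, hole_through e a r b.
Proof.
move=> ps res0.
(* [A] stands for the triples examined so far, in lexicographic order. *)
pose Found (A : nat -> nat -> nat -> bool) s' :=
  [/\ prepared s',
    var s' vRES != 0 -> exists a b c, hole_through e a b c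
  & forall a r b, A a r b -> r < n -> b < n -> hole_through e a r b -> var s' vRES != 0].
rewrite /detect.
have [||s1 [ps1 g1 h1] ->] := @eval_for (fun k => Found (fun a _ _ => a < k)) vA
  (CFor vR (CFor vB triple)) n s (pr_n ps).
- by split; rewrite ?res0.
- move=> a s1 an [ps1 g1 h1].
  have ps1' : prepared (setv s1 vA a) by apply: prepared_setv.
  have [||s2 [[ps2 g2 h2] s2a] ->] := @eval_for (fun k s2 =>
    Found (fun x y _ => (x < a) || (x == a) && (y < k)) s2 /\ var s2 vA = a) vR
    (CFor vB triple) n (setv s1 vA a) (pr_n ps1').
  + by do !split=> //; move=> x y z; rewrite andbF orbF; apply: h1.
  + move=> r s2 rn [[ps2 g2 h2] s2a].
    have ps2' : prepared (setv s2 vR r) by apply: prepared_setv.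
    have [||s3 [[ps3 g3 h3] s3a s3r] ->] := @eval_for (fun k s3 =>
      [/\ Found (fun x y z => [|| x < a, (x == a) && (y < r)
        | [&& x == a, y == r & z < k]]) s3, var s3 vA = a & var s3 vR = r]) vB
      triple n (setv s2 vR r) (pr_n ps2').
    * by do !split=> //; move=> x y z; rewrite !andbF orbF; apply: h2.
    * move=> b s3 bn [[ps3 g3 h3] s3a s3r].
      have at3 : at_triple a r b (setv s3 vB b) by split=> //; apply: prepared_setv.
      have [ps4 f1 f2 f3] := triple_correct an rn bn at3.
      split; [split=> //|by rewrite eval_var|by rewrite eval_var].
        by case/f2.
      move=> x y z; rewrite ltnS leq_eqVlt => hxyz yn zn ht.
      case: (boolP [&& x == a, y == r & z == b]) => [/and3P[/eqP ex /eqP ey /eqP ez]|hn].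
        by apply: f3; rewrite -ex -ey -ez.
      apply: f1; apply: (h3 x y z) => //; lia.
    * split; last by [].
      split=> //; first exact: prepared_setv.
      move=> x y z hxy yn zn; apply: (h3 x y z) => //; lia.
  + split=> //; first exact: prepared_setv.
    move=> x y z hx yn zn; apply: (h2 x y z) => //; lia.
- split=> [|[a [r [b ht]]]]; first exact: g1.
  have [k [c [k5 kodd hc [c0 c1 ck]]]] := ht.
  have [] : e (c 0) (c 1) /\ e (c 0) (c k.-1) by rewrite !hc; lia.
  rewrite c0 c1 ck => /e_lt[rn an] /e_lt[_ bn].
  exact: (h1 a r b).
Qed.

End Detect.

(** * Relocation of the input *)

(* The input overlaps the registers used as variables: the latter are first
   packed in binary into register 1, which is free since it holds adj(0,0) = 0. *)
Definition pack (l : seq nat) : program :=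
  flatten [seq [:: Add vPACK vPACK vPACK; Add vPACK vPACK r] | r <- l].

Fixpoint unpack (l : seq nat) : cmd :=
  match l with
  | [::] => CConst t1 0
  | r :: l' =>
      CConst vA r.-1 ;; CConst vR 0 ;; CConst t1 (2 ^ size l').-1 ;; CSub t1 vPACK t1 ;;
      CWhen t1 (CConst vR 1 ;; CConst t1 (2 ^ size l') ;; CSub vPACK vPACK t1) ;;
      CStore aADJ vA vR ;; unpack l'
  end.

Fixpoint bits (f : nat -> nat) (l : seq nat) : nat :=
  if l is r :: l' then f r * 2 ^ size l' + bits f l' else 0.

(* The copy runs downwards, so that the target [cell aADJ i] never overwrites an
   unread source [i'.+1] with [i' < i]. *)
Definition copy_word :=
  CSub vACC vACC vONE ;; CAdd t1 vACC vONE ;; CRaw t2 t1 ;; CStore aADJ vACC t2.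

Definition low_regs := iota 2 16.

Definition prelude :=
  CConst vRES 0 ;; CConst vONE 1 ;; CConst vACC 0 ;; CFor vU (CAdd vACC vACC vN) ;;
  CFor vU (CFor vV copy_word) ;;
  unpack low_regs ;; CConst t1 0 ;; CStore aADJ t1 t1 ;;
  CConst vACC 0 ;; CFor vU (CStore aROW vU vACC ;; CAdd vACC vACC vN).

Lemma pack_straight l : all straight (pack l).
Proof. by elim: l. Qed.

Lemma eq_bits f g l : {in l, f =1 g} -> bits f l = bits g l.
Proof.
elim: l => //= r l IH fg; rewrite fg ?mem_head // IH // => x xl.
by apply: fg; rewrite inE xl orbT.
Qed.

Lemma bits_lt f l : (forall r, f r <= 1) -> bits f l < 2 ^ size l.
Proof.
move=> f1; elim: l => //= r l IH; rewrite expnS mul2n -addnn.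
by have := f1 r; case: (f r) => [|[|]] //; lia.
Qed.

Lemma pack_correct l R : vPACK \notin l ->
  let R' := foldl (fun R i => effect i R) R (pack l) in
  R' vPACK = R vPACK * 2 ^ size l + bits R l /\ (forall x, x != vPACK -> R' x = R x).
Proof.
elim: l R => [|r l IH] R; first by rewrite /= muln1 addn0.
rewrite inE negb_or => /andP[nr nl] R'.
have -> : R' = foldl (fun R i => effect i R)
   (effect (Add vPACK vPACK r) (effect (Add vPACK vPACK vPACK) R)) (pack l) by [].
set R1 := effect _ _; have [e1 e2] := IH R1 nl.
have h x : x != vPACK -> R1 x = R x by move=> /negbTE hx; rewrite /R1 /= hx.
split; last by move=> x hx; rewrite e2 // h.
rewrite e1; have -> : bits R1 l = bits R l.
  by apply: eq_bits => x xl; apply: h; apply: contraNneq nl => <-.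
rewrite /R1 /= eq_sym (negbTE nr) expnS; lia.
Qed.

(** The first register is the most significant bit. The bits after it form a number below
    [2 ^ size l'], so it is 1 exactly when the truncated difference with [(2 ^ size l').-1] is
    nonzero. Register [r] holds matrix entry [r.-1]. *)
Lemma unpack_correct f l s : (forall r, f r <= 1) -> uniq l -> 0 \notin l ->
  var s vPACK = bits f l ->
  (forall r, r \in l -> arr (eval (unpack l) s) aADJ r.-1 = f r) /\
  (forall j, j.+1 \notin l -> arr (eval (unpack l) s) aADJ j = arr s aADJ j).
Proof.
move=> f1; elim: l s => // r l IH s /= /andP[nrl ul].
rewrite inE negb_or => /andP[r0 n0] hs.
set p := 2 ^ size l in hs *; have bl : bits f l < p := bits_lt l f1.
set s1 := (X in eval (unpack l) X).
have [sP sA] : var s1 vPACK = bits f l /\ arr s1 = arr (seta s aADJ r.-1 (f r)).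
  rewrite /s1; case: (f r) (f1 r) hs => [|[|]] // _ hs; rewrite hs.
    have -> : 0 * p + bits f l - p.-1 = 0 by lia.
    by rewrite eqxx /= hs mul0n.
  have -> : (1 * p + bits f l - p.-1 == 0) = false by lia.
  by rewrite /=; split=> //=; rewrite ?hs; lia.
have [h1 h2] := IH s1 ul n0 sP; split=> [x|j].
  rewrite inE => /predU1P[->|]; last exact: h1.
  by rewrite h2 ?sA /= ?eqxx // prednK // lt0n eq_sym.
rewrite inE negb_or => /andP[jr jl]; rewrite h2 // sA /=.
by case: eqP => // jr'; rewrite jr' prednK ?eqxx // lt0n eq_sym in jr.
Qed.

(** * Correctness of the relocation *)

Section Prelude.
Variables (n : nat) (inp : nat -> nat).

(** State after [m] words, counted from the last one. [mv_done] leaves out the entries whose source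
    register is a variable; these come from the packed word. [mv_todo] lists cells that still hold
    the input. *)
Record copied (m : nat) (s : store) : Prop := Copied {
  mv_n : var s vN = n;
  mv_one : var s vONE = 1;
  mv_acc : var s vACC = n * n - m;
  mv_done : forall i, n * n - m <= i -> i < n * n -> nvars.-1 <= i -> arr s aADJ i = inp i.+1;
  mv_todo : forall k j, k < 8 -> (k != 0) || (j < n * n - m) -> arr s k j = inp (cell k j) }.

Lemma copy_word_correct m s : m < n * n -> copied m s -> copied m.+1 (eval copy_word s).
Proof.
move=> hm [h1 h2 h3 h4 h5]; have acc : n * n - m - 1 = n * n - m.+1 by lia.
have acc' : n * n - m.+1 + 1 = n * n - m by lia.
rewrite /copy_word !eval_seq /= h2 h3 acc acc'; split=> //= [i hi1 hi2 hi3|k j k8 hkj].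
- case: eqP => [ei|ni]; last by apply: h4 => //; lia.
  rewrite ei in hi3 *.
  rewrite /raw ifN /=; last by rewrite -leqNgt; move: hi3; rewrite /nvars; lia.
  rewrite h5 ?ltn_mod //; last by rewrite /nvars in hi3 *; lia.
  by congr inp; rewrite /cell /nvars in hi3 *; lia.
- rewrite ifN; first by apply: h5 => //; lia.
  by apply/negP; lia.
Qed.

Lemma copied_setv m s x v : [&& vN != x, vONE != x & vACC != x] -> copied m s ->
  copied m (setv s x v).
Proof.
by case/and3P=> /negbTE h1 /negbTE h2 /negbTE h3 [p1 p2 p3 p4 p5]; split;
  rewrite /= /upd ?h1 ?h2 ?h3.
Qed.

Lemma copy_word_all s : copied 0 s -> copied (n * n) (eval (CFor vU (CFor vV copy_word)) s).
Proof.
move=> h0.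
have [||s1 h1 ->] := @eval_for (fun k => copied (k * n)) vU (CFor vV copy_word) n s (mv_n h0).
- by rewrite mul0n.
- move=> k s1 kn h1; have h1' : copied (k * n) (setv s1 vU k) by apply: copied_setv.
  have [||s2 h2 ->] := @eval_for (fun j => copied (k * n + j)) vV copy_word n _ (mv_n h1').
  + by rewrite addn0.
  + move=> j s2 jn h2; rewrite addnS; apply: copy_word_correct; last exact: copied_setv.
    by nia.
  + by rewrite mulSn addnC; apply: copied_setv.
- exact: copied_setv.
Qed.

Lemma prelude_correct (e : rel nat) s : 0 < n ->
  (forall a, 0 < a -> inp a <= 1) -> inp 1 = 0 ->
  (forall x y, x < n -> y < n -> inp (x * n + y).+1 = e x y) ->
  var s vN = n -> var s vPACK = bits inp low_regs ->
  (forall k j, k < 8 -> arr s k j = inp (cell k j)) ->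
  prepared n e (eval prelude s) /\ var (eval prelude s) vRES = 0.
Proof.
move=> n0 inp1 inp10 inpE sn sp sa; rewrite /prelude 3!eval_seq.
set s0 := eval (CConst vACC 0) _.
rewrite eval_seq; set s1 := eval (CFor vU (CAdd _ _ _)) s0.
have s1acc : var s1 vACC = n * n.
  have [||s' [_ h] es] := @eval_for (fun k s' => var s' vN = n /\ var s' vACC = k * n) vU
    (CAdd vACC vACC vN) n s0 sn; last by rewrite /s1 es.
  - by rewrite /s0 /= sn.
  - by move=> k s' kn [h1 h2]; rewrite /= h1 h2 mulSn addnC.
have m0 : copied 0 s1.
  split.
  - by rewrite eval_var.
  - by rewrite eval_var.
  - by rewrite subn0.
  - by move=> i h1 h2; lia.
  - by move=> k j k8 _; rewrite !eval_arr // sa.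
rewrite eval_seq; set s2 := eval _ s1; have m2 : copied (n * n) s2 := copy_word_all m0.
rewrite eval_seq; set s3 := eval _ s2.
(* Register 0 holds [n] rather than a bit, so it is masked to make every value of [f] at most 1. *)
pose f r := if r == 0 then 0 else inp r.
have f1 r : f r <= 1 by rewrite /f; case: eqP => // /eqP h; apply: inp1; rewrite lt0n.
have s2p : var s2 vPACK = bits f low_regs.
  by rewrite !eval_var // sp; apply: eq_bits => r; rewrite /f; case: eqP => // ->.
have [u1 u2] := @unpack_correct f low_regs s2 f1 (iota_uniq _ _) isT s2p.
rewrite -/s3 in u1 u2.
have [s3n s3one s3res] : [/\ var s3 vN = n, var s3 vONE = 1 & var s3 vRES = 0].
  by split; rewrite [var s3 _]eval_var // [var s2 _]eval_var // [var s1 _]eval_var //.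
move: s3 u1 u2 s3n s3one s3res => s3 u1 u2 s3n s3one s3res.
rewrite 2!eval_seq; set s4 := eval (CStore _ _ _) _.
have s4adj i : i < n * n -> arr s4 aADJ i = inp i.+1.
  move=> hi; rewrite /s4 /=; case: eqP => [->|/eqP i0] //.
  case: (boolP (i.+1 \in low_regs)) => hl; first by rewrite (u1 _ hl).
  rewrite u2 // (mv_done m2) ?subnn //.
  by move: hl; rewrite mem_iota /nvars; lia.
have s4n : var s4 vN = n by [].
have s4one : var s4 vONE = 1 by [].
rewrite eval_seq; set s5 := eval (CConst vACC 0) s4.
have [||s' [h1 h2 h3 h4 h5] ->] := @eval_for (fun k s' =>
  [/\ var s' vN = n, var s' vONE = 1, var s' vACC = k * n,
      forall x, x < k -> arr s' aROW x = x * n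
    & arr s' aADJ = arr s4 aADJ /\ var s' vRES = 0]) vU
  (CStore aROW vU vACC ;; CAdd vACC vACC vN) n s5 s4n.
- by split=> //; split.
- move=> k s' kn [h1 h2 h3 h4 [h5 h6]]; rewrite /= h1 h3; split=> //.
  + by rewrite mulSn addnC.
  + move=> x; rewrite ltnS leq_eqVlt => /predU1P[->|xk]; first by rewrite eqxx.
    by rewrite ltn_eqF // h4.
- case: h5 => h5 h6; split=> //; split=> // x y xn yn.
  by rewrite /= h5 s4adj ?inpE //; nia.
Qed.

End Prelude.

(** * From graphs on ordinals to relations on [nat] *)

Section Graph.
Variables (n : nat) (adj : rel 'I_n).

Definition nat_adj (x y : nat) : bool :=
  [exists u : 'I_n, exists v : 'I_n, [&& x == u, y == v & adj u v]].

Lemma nat_adjP (x y : nat) :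
  reflect (exists u v : 'I_n, [/\ x = u, y = v & adj u v]) (nat_adj x y).
Proof.
apply: (iffP existsP) => [[u /existsP[v /and3P[/eqP-> /eqP-> h]]]|[u [v [-> -> h]]]].
  by exists u, v.
by exists u; apply/existsP; exists v; rewrite !eqxx.
Qed.

Lemma nat_adj_ord (u v : 'I_n) : nat_adj u v = adj u v.
Proof.
apply/nat_adjP/idP => [[u' [v' [/ord_inj-> /ord_inj->]]] //|h].
by exists u, v.
Qed.

Lemma nat_adj_lt x y : nat_adj x y -> x < n /\ y < n.
Proof. by case/nat_adjP=> u [v [-> -> _]]; split. Qed.

Lemma nat_adj_sym : symmetric adj -> symmetric nat_adj.
Proof.
move=> h x y; apply/nat_adjP/nat_adjP => [] [u [v [-> -> a]]]; exists v, u; by rewrite h.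
Qed.

Lemma nat_adj_irr : irreflexive adj -> irreflexive nat_adj.
Proof. by move=> h x; apply/nat_adjP => [] [u [v [-> /ord_inj->]]]; rewrite h. Qed.

(** The adjacencies and nonadjacencies of the pattern force the five vertices to be distinct, so
    they define an embedding of the bull. *)
Lemma nat_adj_bull : symmetric adj -> irreflexive adj -> bull_free adj -> no_bull nat_adj.
Proof.
move=> hs hi bf x y z p q /nat_adjP[u [v [-> -> uv]]] /nat_adjP[v' [w [/ord_inj<- -> vw]]].
rewrite nat_adj_ord => uw /nat_adjP[p' [u' [-> /ord_inj<- pu]]].
move=> /nat_adjP[q' [v'' [-> /ord_inj<- qv]]]; rewrite !nat_adj_ord.
move=> /negbTE pv /negbTE pw /negbTE qu /negbTE qw /negbTE pq; apply: bf.
pose l := [:: u; v; w; p'; q'].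
have wv := hs w v; have wu := hs w u.
have ul : uniq l.
  rewrite /= !inE !negb_or; do !(apply/andP; split) => //; apply/eqP => h; subst => //;
    move: wv wu uv vw uw pu qv pv pw qu qw pq; rewrite /is_true ?hi => *; congruence.
exists (fun i : 'I_5 => nth u l i); split.
  move=> i j /eqP; rewrite nth_uniq //; first by move=> /eqP/ord_inj.
move=> [[|[|[|[|[|//]]]]] hi'] [[|[|[|[|[|//]]]]] hj]; rewrite /bull_rel /= ?hi //.
all: by rewrite // hs.
Qed.

(** An odd length of at least 4 is at least 5, and any vertex of the hole can serve as [r]. The rest
    translates successors modulo [k] into the explicit closing pair [0], [k.-1]. *)
Lemma odd_holeP : symmetric adj -> irreflexive adj ->
  (exists a r b, hole_through nat_adj a r b) <-> has_odd_hole adj.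
Proof.
move=> hs hi; split.
  case=> a [r [b [k [c [k5 kodd hc _]]]]].
  exists k; split=> //; first exact: ltnW.
  have cn i : i < k -> c i < n.
    move=> ik; case: (posnP i) => [->|i0].
      have : nat_adj (c 0) (c 1) by rewrite hc //; lia.
      by case/nat_adj_lt.
    have : nat_adj (c i.-1) (c i) by rewrite hc //; lia.
    by case/nat_adj_lt.
  exists (fun i : 'I_k => Ordinal (cn i (ltn_ord i))); split.
    move=> i j /(congr1 val) /= h; apply: ord_inj.
    have inj := hole_inj (nat_adj_sym hs) (nat_adj_irr hi) k5 hc.
    case: (ltngtP i j) => // ij; first by case: (inj _ _ ij (ltn_ord j) h).
    by case: (inj _ _ ij (ltn_ord i) (esym h)).
  have wlt (i j : 'I_k) : i < j -> nat_adj (c i) (c j) = cycle_rel i j.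
    move=> ij; rewrite hc // /cycle_rel /=.
    have -> : (j == i.+1 %% k :> nat) = (j == i.+1 :> nat).
      by rewrite modn_small //; apply: leq_ltn_trans ij (ltn_ord j).
    congr orb; have := ltn_ord j; rewrite leq_eqVlt => /predU1P[jk|jk].
      by rewrite jk modnn; case: eqP => //= _; lia.
    by rewrite modn_small //; lia.
  move=> i j; rewrite -nat_adj_ord /=.
  case: (ltngtP i j) => ij; first exact: wlt.
    by rewrite nat_adj_sym // wlt // /cycle_rel orbC.
  rewrite ij nat_adj_irr // /cycle_rel (ord_inj ij) orbb.
  have := ltn_ord j; rewrite leq_eqVlt => /predU1P[jk|jk].
    by rewrite jk modnn /=; lia.
  by rewrite modn_small //; rewrite /=; lia.
case=> -[|k] [k4 kodd [f [finj fadj]]] //.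
pose c i := val (f (inord i)).
exists (c 1), (c 0), (c k), k.+1, c; split=> //; first by lia.
move=> i j ij jk; rewrite /c nat_adj_ord fadj /cycle_rel /= !inordK //; last by lia.
rewrite [i.+1 %% _]modn_small; last by lia.
congr orb; move: jk; rewrite ltnS leq_eqVlt => /predU1P[->|jk].
  by rewrite modnn eqxx andbT.
by rewrite modn_small //; lia.
Qed.

Lemma init_input x y : x < n -> y < n -> (init adj).2 (x * n + y).+1 = nat_adj x y.
Proof.
move=> xn yn /=; congr nat_of_bool; apply/existsP/nat_adjP => [[u /existsP[v]]|].
  rewrite eqSS => /andP[/eqP h a]; exists u, v.
  have n0 : 0 < n by apply: leq_ltn_trans xn.
  have := congr1 (divn^~ n) h; have := congr1 (modn^~ n) h.
  by rewrite /= !modnMDl !divnMDl // !modn_small // !divn_small // !addn0.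
by case=> u [v [-> -> a]]; exists u; apply/existsP; exists v; rewrite eqxx.
Qed.

End Graph.

(** * The assembled machine and its running time *)

Definition entry (l : seq nat) : nat := (size (pack l)).+1.
Definition finish (l : seq nat) (c : cmd) : nat := entry l + size (compile (entry l) c) + 2.
(** The first jump settles [n = 0], where register 0 already gives the answer no. The last two
    instructions move [vRES] to register 0, and [finish] is the address just past the code, where
    the machine halts. *)
Definition machine (l : seq nat) (c : cmd) : program :=
  Jz vN (finish l c) ::
  pack l ++ compile (entry l) c ++ [:: Const scratch1 0; Add vN vRES scratch1].

Lemma exec_halted p t t' s : t <= t' -> halted p (exec p t s) -> exec p t' s = exec p t s.
Proof.
move=> /subnKC<- h; rewrite exec_add; move: (exec p t s) h => [pc R] h.
elim: (t' - t) => // m IH; rewrite -[m.+1]addn1 exec_add IH /exec /=.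
by move: h; rewrite /halted /=; case: nth.
Qed.

Lemma machine_halted l c R : halted (machine l c) (finish l c, R).
Proof.
have : size (machine l c) <= finish l c.
  by rewrite /machine /= !size_cat /= /finish /entry addSn addnA.
by rewrite /halted => h; rewrite nth_default.
Qed.

Lemma machine_run l c n R : wf c -> vPACK \notin l -> 0 < n -> R vN = n ->
  exists t R' s,
  [/\ t <= entry l + cost n c + 2, exec (machine l c) t (0, R) = (finish l c, R'),
      R' 0 = var (eval c s) vRES
    & [/\ var s vN = n, var s vPACK = R vPACK * 2 ^ size l + bits R l
        & forall k j, k < 8 -> arr s k j = R (cell k j)]].
Proof.
move=> wfc nl n0 Rn.
have [h0 h1] : nth Halt (machine l c) 0 = Jz vN (finish l c) /\
    fetch (machine l c) 1
      (pack l ++ compile (entry l) c ++ [:: Const scratch1 0; Add vN vRES scratch1]).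
  exact: fetch_cons.
have [h2 /fetch_cat[h3 h4]] := fetch_cat h1.
have e1 := exec_jz R h0; rewrite Rn eqn0Ngt n0 in e1.
have [pk1 pk2] := pack_correct R nl.
have e2 := exec_straight R h2 (pack_straight _).
set R1 := foldl _ _ _ in e2 pk1 pk2.
(* The initial store is read off the registers after packing, so its arrays still contain the raw
   input. *)
pose s := Store R1 (fun k j => R1 (cell k j)).
have sn : var s vN = n by rewrite /= pk2.
have rs : rep R1 s by [].
have [t [R2 [ht e3 [rv _]]]] := compile_correct wfc h3 rs sn n0.
have e4 := exec_straight R2 h4 isT.
exists (1 + (size (pack l) + (t + 2))), (foldl (fun R i => effect i R) R2
  [:: Const scratch1 0; Add vN vRES scratch1]), s; split.
- by rewrite /entry; lia.
- by rewrite exec_add e1 exec_add e2 exec_add e3 e4.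
- by rewrite /= addn0 rv.
- by split=> // k j k8; rewrite /= pk2 // /cell /nvars; lia.
Qed.

(* There is a RAM program p and a constant c such that for every bull-free
   (simple) graph G on n vertices, p halts on the encoding of G within
   c * n^5 + c steps, and its output (register 0 nonzero) says whether G
   contains an odd hole. *)
Theorem theorem1p2 :
  exists (p : program) (c : nat),
    forall (n : nat) (adj : rel 'I_n),
      symmetric adj -> irreflexive adj -> bull_free adj ->
      let s := exec p (c * n ^ 5 + c) (init adj) in
      halted p s /\ (s.2 0 != 0 <-> has_odd_hole adj).
Proof.
pose l := low_regs; pose c := prelude ;; detect.
(* [factor c] bounds the structured program, [entry l] the first jump and the packing, and 2 the
   final move. *)
exists (machine l c), (factor c + entry l + 2) => n adj hs hi bf s.
suff [t [R [ht et hR]]] : exists t R,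
    [/\ t <= (factor c + entry l + 2) * n ^ 5 + (factor c + entry l + 2),
      exec (machine l c) t (init adj) = (finish l c, R) & R 0 != 0 <-> has_odd_hole adj].
  have hh := machine_halted l c R; rewrite -et in hh.
  by rewrite /s (exec_halted ht hh) et; split=> //; apply: machine_halted.
set R0 := (init adj).2; have -> : init adj = (0, R0) by [].
case: (posnP n) => [n0|n0].
  have R00 : R0 0 = 0 := n0.
  exists 1, R0; split.
  - by rewrite addn2 [X in 0 < X]addnS.
  - by rewrite (@exec_jz _ _ vN (finish l c)) // R00.
  rewrite R00; split=> // -[k [k4 _ [f _]]].
  have k0 : 0 < k by apply: leq_trans k4.
  by have := leq_ltn_trans (leq0n _) (ltn_ord (f (Ordinal k0))); rewrite n0.
have wfc : wf c by [].
have [t [R [s0 [ht et hR [s0n s0p s0a]]]]] :=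
  machine_run (R := R0) wfc (isT : vPACK \notin l) n0 erefl.
have inp10 : R0 1 = 0.
  by have := init_input adj n0 n0; rewrite mul0n -/R0 => ->; rewrite nat_adj_irr.
have inp1 a : 0 < a -> R0 a <= 1 by case: a => // a _; rewrite /R0 /=; case: [exists _, _].
rewrite inp10 mul0n add0n in s0p.
have [ps res0] := prelude_correct n0 inp1 inp10 (@init_input n adj) s0n s0p s0a.
have det := detect_correct (nat_adj_sym hs) (nat_adj_irr hi) (@nat_adj_lt n adj)
  (nat_adj_bull hs hi bf) ps res0.
exists t, R; split=> //; last by rewrite -odd_holeP // -det hR.
(* Three loops choose the triple; the search and the edge test each nest two more. *)
have dc : depth c <= 5 by [].
have hc := cost_poly c n0.
have hd : n ^ depth c <= n ^ 5 by rewrite leq_pexp2l.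
move: ht hc hd; move: (entry l) (cost n c) (factor c) (n ^ depth c) (n ^ 5) => a b d m m' *.
by nia.
Qed.
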